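(* Let $K\hookrightarrow L$ be a weighted graph pair with $L$ connected. Then $$\frac{\left(h^{K,L}\right)^2}{2\,d_{\max}^{K,L}}\le \lambda_{0,2}^{K,L}\le 2\,h^{K,L},$$ where $d_{\max}^{K,L}=\max_{v\in V^K}\deg^L(v)$ and $\lambda_{0,2}^{K,L}$ is the second smallest eigenvalue (counted with multiplicity) of the $0$-th persistent Laplacian $\Delta_0^{K,L}$.
   Context: A weighted graph $G=(V^G,E^G,w^G)$ is a finite simple graph, viewed as a simplicial complex of dimension at most $1$ on a finite totally ordered vertex set, with positive edge weights $w^G(e)$, $e\in E^G$; all vertices have weight $1$. $\deg^G(v)=\sum_{w:\{v,w\}\in E^G}w^G(\{v,w\})$. The Laplacian matrix $\boldsymbol{\Delta}_0^G$ has diagonal entries $\deg^G(v)$, entries $-w^G(\{v,w\})$ for edges $\{v,w\}$, and $0$ otherwise. A graph pair $K\hookrightarrow L$ consists of weighted graphs with $V^K\subseteq V^L$, $E^K\subseteq E^L$ and $w^K=w^L|_K$. Here $V^K$ is assumed to have at least two elements (so that the quantities are defined). Persistent Laplacian: $C_0^G$ is the real vector space with orthonormal basis the vertices of $G$; $C_1^G$ has basis the oriented edges $[v,w]$ ($v<w$), orthogonal with $\langle[v,w],[v,w]\rangle=w^G(\{v,w\})^{-1}$; $\partial_1^G[v,w]=[w]-[v]$. Let $C_1^{L,K}=\{c\in C_1^L:\partial_1^Lc\in C_0^K\}$ with the inner product restricted from $C_1^L$ and $\partial_1^{L,K}:C_1^{L,K}\to C_0^K$ the restriction of $\partial_1^L$.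 Then $\Delta_0^{K,L}=\partial_1^{L,K}(\partial_1^{L,K})^*$, an operator on $C_0^K$. Effective conductance: for a connected weighted graph $G$ and nonempty disjoint $A,B\subseteq V^G$, put $V^J=A\cup B$ and let $S$ be the Schur complement of the block of $\boldsymbol{\Delta}_0^G$ indexed by $V^G\setminus V^J$, i.e. $S=\boldsymbol{\Delta}_0^G(V^J,V^J)-\boldsymbol{\Delta}_0^G(V^J,I)\,\boldsymbol{\Delta}_0^G(I,I)^\dagger\,\boldsymbol{\Delta}_0^G(I,V^J)$ with $I=V^G\setminus V^J$ ($S=\boldsymbol{\Delta}_0^G$ if $I=\emptyset$; $\dagger$ is the Moore–Penrose inverse). The effective resistance is $\mathfrak{R}^G_{A,B}=(\chi_A^{\mathrm T}S\chi_A)^{-1}$, where $\chi_A\in\mathbb{R}^{V^J}$ is the indicator vector of $A$, and the effective conductance is $\mathfrak{C}^G_{A,B}=1/\mathfrak{R}^G_{A,B}$. Persistent Cheeger constant: $$h^{K,L}=\min_{\emptyset\ne A\subsetneq V^K,\ |A|\le\frac12|V^K|}\frac{\mathfrak{C}^L_{A,V^K\setminus A}}{|A|}.$$ *)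

(* Defs.v *)
From HB Require Import structures.
From mathcomp Require Import all_boot all_order all_algebra.
From mathcomp Require Import boolp classical_sets reals.

Set Implicit Arguments.
Unset Strict Implicit.
Unset Printing Implicit Defensive.

Import Order.TTheory GRing.Theory Num.Theory.
Local Open Scope ring_scope.

Section Matrices.
Variable R : realType.

Definition penrose m n (A : 'M[R]_(m, n)) (X : 'M[R]_(n, m)) : bool :=
  [&& A *m X *m A == A, X *m A *m X == X,
      (A *m X)^T == A *m X & (X *m A)^T == X *m A].

Lemma mxTmul_unit m n (B : 'M[R]_(m, n)) : row_free B -> B *m B^T \in unitmx.
Proof.
move=> Bfree; rewrite -row_free_unit -kermx_eq0; apply/eqP/row_matrixP => i.
rewrite row0; set u := row i _.
have uBB : u *m (B *m B^T) = 0 by rewrite /u -row_mul mulmx_ker row0.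
have uB2 : (u *m B) *m (u *m B)^T = 0.
  by rewrite trmx_mul mulmxA -(mulmxA u) uBB mul0mx.
have uB : u *m B = 0.
  apply/rowP => j; rewrite [RHS]mxE.
  move/matrixP: uB2 => /(_ 0 0); rewrite [LHS]mxE [RHS]mxE => /eqP.
  rewrite psumr_eq0 => [/allP/(_ j)|k _]; last by rewrite [_^T _ _]mxE -expr2 sqr_ge0.
  by rewrite mem_index_enum => /(_ isT); rewrite [_^T _ _]mxE -expr2 sqrf_eq0 => /eqP.
by apply: (row_free_inj Bfree); rewrite uB mul0mx.
Qed.

Lemma penrose_ex m n (A : 'M[R]_(m, n)) : exists X, penrose A X.
Proof.
have [r [C [B [AE uB uC]]]] : exists r (C : 'M_(m, r)) (B : 'M_(r, n)),
  [/\ A = C *m B, B *m B^T \in unitmx & C^T *m C \in unitmx].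
  exists (\rank A), (col_base A), (row_base A); split.
  - by rewrite mulmx_base.
  - by apply: mxTmul_unit; exact: row_base_free.
  - rewrite -{2}[col_base A]trmxK; apply: mxTmul_unit.
    by rewrite /row_free mxrank_tr; exact: col_base_full.
pose Y := invmx (C^T *m C); pose Z := invmx (B *m B^T).
have YC : Y *m C^T *m C = 1%:M by rewrite -mulmxA mulVmx.
have BZ : B *m (B^T *m Z) = 1%:M by rewrite mulmxA mulmxV.
have YT : Y^T = Y by rewrite trmx_inv trmx_mul trmxK.
have ZT : Z^T = Z by rewrite trmx_inv trmx_mul trmxK.
pose X := (B^T *m Z) *m (Y *m C^T).
have AX : A *m X = C *m (Y *m C^T).
  by rewrite AE /X mulmxA -(mulmxA C) BZ mulmx1.
have XA : X *m A = (B^T *m Z) *m B.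
  by rewrite AE /X mulmxA -(mulmxA (B^T *m Z)) YC mulmx1.
exists X; apply/and4P; split; apply/eqP.
- by rewrite AX {1}AE mulmxA -(mulmxA C) YC mulmx1 -AE.
- by rewrite XA /X -mulmxA (mulmxA B) BZ mul1mx.
- by rewrite AX !trmx_mul YT trmxK mulmxA.
- by rewrite XA !trmx_mul ZT trmxK mulmxA.
Qed.

Definition mpinv m n (A : 'M[R]_(m, n)) : 'M[R]_(n, m) :=
  xchoose (penrose_ex A).

Lemma mpinvP m n (A : 'M[R]_(m, n)) : penrose A (mpinv A).
Proof. exact: xchooseP. Qed.

Lemma penrose_uniq m n (A : 'M[R]_(m, n)) X Y :
  penrose A X -> penrose A Y -> X = Y.
Proof.
case/and4P=> /eqP x1 /eqP x2 /eqP x3 /eqP x4.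
case/and4P=> /eqP y1 /eqP y2 /eqP y3 /eqP y4.
have AXY : A *m X = A *m Y.
  by rewrite -x3 -{1}y1 -(mulmxA (A *m Y)) trmx_mul x3 y3 mulmxA x1.
have XYA : X *m A = Y *m A.
  by rewrite -x4 -{1}y1 -(mulmxA A) mulmxA trmx_mul x4 y4 -mulmxA (mulmxA A) x1.
by rewrite -x2 XYA -mulmxA AXY mulmxA y2.
Qed.

End Matrices.

Section Adjoint.
Variables (R : realType) (U V : vectType R).

Definition is_adjoint (ipU : U -> U -> R) (ipV : V -> V -> R)
    (f : 'Hom(U, V)) (g : 'Hom(V, U)) : Prop :=
  forall u v, ipV (f u) v = ipU u (g v).

Definition adjoint (ipU : U -> U -> R) (ipV : V -> V -> R)
    (f : 'Hom(U, V)) : 'Hom(V, U) :=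
  xget 0 [set g | is_adjoint ipU ipV f g]%classic.

Lemma adjointP (ipU : U -> U -> R) (ipV : V -> V -> R) (f : 'Hom(U, V)) :
  (forall y, linear (fun x => ipU x y : R^o)) ->
  (forall x, linear (fun y => ipU x y : R^o)) ->
  (forall x, ipU x x = 0 -> x = 0) ->
  (forall y, linear (fun x => ipV x y : R^o)) ->
  (forall x, linear (fun y => ipV x y : R^o)) ->
  is_adjoint ipU ipV f (adjoint ipU ipV f).
Proof.
move=> Ul Ur Ud Vl Vr; apply: xgetPex.
pose mU y := GRing.isLinear.Build R U R^o *:%R _ (Ul y).
pose FU y : {linear U -> R^o} := HB.pack (fun x => ipU x y : R^o) (mU y).
pose mV y := GRing.isLinear.Build R V R^o *:%R _ (Vl y).
pose FV y : {linear V -> R^o} := HB.pack (fun x => ipV x y : R^o) (mV y).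
have FUE y x : linfun (FU y) x = ipU x y by rewrite lfunE.
have FVE y x : linfun (FV y) x = ipV x y by rewrite lfunE.
have phiL : linear (fun y => linfun (FU y)).
  by move=> a x y; apply/lfunP => z; rewrite add_lfunE scale_lfunE !FUE; exact: Ur.
pose mp := GRing.isLinear.Build R U 'Hom(U, R^o) *:%R _ phiL.
pose phi : {linear U -> 'Hom(U, R^o)} := HB.pack (fun y => linfun (FU y)) mp.
have psiL : linear (fun y => (linfun (FV y) \o f)%VF).
  by move=> a x y; apply/lfunP => z; rewrite add_lfunE scale_lfunE !comp_lfunE !FVE; exact: Vr.
pose mq := GRing.isLinear.Build R V 'Hom(U, R^o) *:%R _ psiL.
pose psi : {linear V -> 'Hom(U, R^o)} :=
  HB.pack (fun y => (linfun (FV y) \o f)%VF) mq.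
have ker0 : lker (linfun phi) = 0%VS.
  apply/eqP; rewrite -subv0; apply/subvP => x; rewrite memv_ker memv0 lfunE /=.
  by move=> /eqP/lfunP/(_ x); rewrite FUE zero_lfunE => /Ud ->.
have im : limg (linfun phi) = fullv.
  apply/eqP; rewrite eqEdim subvf limg_dim_eq ?ker0 ?capv0 //=.
  by rewrite !dimvf /dim /= muln1.
exists ((linfun phi)^-1 \o linfun psi)%VF => u v.
have /lfunP/(_ u) : linfun phi (((linfun phi)^-1 \o linfun psi)%VF v) = psi v.
  by rewrite comp_lfunE limg_lfunVK ?im ?memvf // lfunE.
by rewrite [linfun phi _]lfunE; move=> e; rewrite -FUE -FVE -comp_lfunE; exact: esym.
Qed.

Lemma adjoint_uniq (ipU : U -> U -> R) (ipV : V -> V -> R) f g h :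
  (forall x, linear (fun y => ipU x y : R^o)) ->
  (forall x, ipU x x = 0 -> x = 0) ->
  is_adjoint ipU ipV f g -> is_adjoint ipU ipV f h -> g = h.
Proof.
move=> Ur Ud fg fh; apply/lfunP => v; apply/eqP; rewrite -subr_eq0; apply/eqP.
apply: Ud; set x := _ - _; rewrite {2}/x -scaleN1r addrC.
by have /= -> := Ur x (-1) (h v) (g v); rewrite -fg -fh scaleN1r addNr.
Qed.

End Adjoint.

Section Spectrum.
Variables (R : realType) (V : vectType R).

Definition char_poly_lfun (f : 'End(V)) : {poly R} :=
  char_poly (passmx.mxof (vbasis {:V}) (vbasis {:V}) f).

(* Eigenvalues in increasing order, repeated according to multiplicity; only
   meaningful when the characteristic polynomial splits over [R], as it does
   for self-adjoint [f]. *)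
Definition spectrum (f : 'End(V)) : seq R :=
  xget [::] [set s : seq R | sorted <=%R s /\
    char_poly_lfun f = \prod_(a <- s) ('X - a%:P)]%classic.

Definition kth_eigenvalue (f : 'End(V)) (k : nat) : R := (spectrum f)`_k.-1.

End Spectrum.

Section WeightedGraphs.
Variables (R : realType) (d : Order.disp_t) (T : finOrderType d).

(* Edges are two-element subsets of the vertex set; the values of [weight]
   outside [edges] are irrelevant. *)
Record wgraph := WGraph {
  vertices : {set T};
  edges : {set {set T}};
  weight : {set T} -> R;
  edges_wf : forall e, e \in edges -> #|e| = 2%N /\ e \subset vertices;
  weight_gt0 : forall e, e \in edges -> 0 < weight e
}.

Definition graph_pair (K L : wgraph) : Prop :=
  [/\ vertices K \subset vertices L, edges K \subset edges L &
      forall e, e \in edges K -> weight K e = weight L e].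

Definition connected_graph (G : wgraph) : Prop :=
  forall u v, u \in vertices G -> v \in vertices G ->
    connect (fun x y => [set x; y]%SET \in edges G) u v.

Definition deg (G : wgraph) (v : T) : R :=
  \sum_(w in vertices G | [set v; w]%SET \in edges G) weight G [set v; w]%SET.

Definition laplacian_entry (G : wgraph) (v w : T) : R :=
  if v == w then deg G v
  else if [set v; w]%SET \in edges G then - weight G [set v; w]%SET else 0.

(* The block of the Laplacian matrix with rows [A] and columns [B]. *)
Definition laplacian_block (G : wgraph) (A B : {set T}) : 'M[R]_(#|A|, #|B|) :=
  \matrix_(i, j) laplacian_entry G (enum_val i) (enum_val j).

Definition laplacian (G : wgraph) := laplacian_block G (vertices G) (vertices G).

(* For [VJ = vertices G] the subtracted term is an empty sum. *)
Definition schur (G : wgraph) (VJ : {set T}) : 'M[R]_#|VJ| :=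
  let I := (vertices G :\: VJ)%SET in
  laplacian_block G VJ VJ
  - laplacian_block G VJ I *m mpinv (laplacian_block G I I)
    *m laplacian_block G I VJ.

Definition eff_resistance (G : wgraph) (A B : {set T}) : R :=
  let chi : 'cV[R]_#|(A :|: B)%SET| := \col_i (enum_val i \in A)%:R in
  ((chi^T *m schur G (A :|: B)%SET *m chi) 0 0)^-1.

Definition eff_conductance (G : wgraph) (A B : {set T}) : R :=
  1 / eff_resistance G A B.

Definition cheeger_admissible (K : wgraph) (A : {set T}) : Prop :=
  [/\ A != finset.set0, A \proper vertices K &
      #|A|%:R <= 2^-1 * #|vertices K|%:R :> R].

Definition cheeger_ratio (K L : wgraph) (A : {set T}) : R :=
  eff_conductance L A (vertices K :\: A)%SET / #|A|%:R.

(* The infimum of a finite set, hence a minimum; see [cheeger_min]. *)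
Definition cheeger (K L : wgraph) : R :=
  inf (cheeger_ratio K L @` [set A | cheeger_admissible K A])%classic.

Lemma cheeger_min (K L : wgraph) : (1 < #|vertices K|)%N ->
  exists2 A, cheeger_admissible K A & cheeger K L = cheeger_ratio K L A /\
    forall B, cheeger_admissible K B -> cheeger_ratio K L A <= cheeger_ratio K L B.
Proof.
move=> K1; have /card_gt0P[v vK] : (0 < #|vertices K|)%N by exact: ltnW.
have v_adm : cheeger_admissible K [set v]%SET.
  split; first by apply/set0Pn; exists v; rewrite inE.
  - by rewrite properEcard finset.sub1set vK cards1.
  - by rewrite cards1 mulrC ler_pdivlMr ?ltr0n // mul1r ler_nat.
pose P A := `[< cheeger_admissible K A >].
have {}v_adm : P [set v]%SET by exact/asboolP.
case: (@Order.TotalTheory.arg_minP _ _ _ _ P (cheeger_ratio K L) v_adm) => A.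
move=> /asboolP A_adm A_min.
have A_lb B : cheeger_admissible K B -> cheeger_ratio K L A <= cheeger_ratio K L B.
  by move=> ?; apply: A_min; apply/asboolP.
exists A => //; split=> //; apply/eqP; rewrite eq_le; apply/andP; split.
  apply: ge_inf; last by exists A.
  by exists (cheeger_ratio K L A) => _ [B /A_lb + <-].
by apply: lb_le_inf; [exists (cheeger_ratio K L A), A|move=> _ [B /A_lb + <-]].
Qed.

(* Degrees are nonnegative, so the default value [0] is harmless. *)
Definition dmax (K L : wgraph) : R := \big[Num.max/0]_(v in vertices K) deg L v.

(* All chain spaces live in [chain0] and [chain1], the real vector spaces on
   all points and on all ordered pairs, so that the inclusion of [C0 K] into
   [C0 L] is an inclusion of subspaces. *)
Definition chain0 := {ffun T -> R^o}.
Definition chain1 := {ffun T * T -> R^o}.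

Definition vertex_chain (v : T) : chain0 := [ffun u => (u == v)%:R].
Definition edge_chain (p : T * T) : chain1 := [ffun q => (q == p)%:R].

Definition oriented_edges (G : wgraph) : {set T * T} :=
  [set p : T * T | (p.1 < p.2)%O && ([set p.1; p.2]%SET \in edges G)]%SET.

Definition C0 (G : wgraph) : {vspace chain0} :=
  <<[seq vertex_chain v | v in vertices G]>>%VS.
Definition C1 (G : wgraph) : {vspace chain1} :=
  <<[seq edge_chain p | p in oriented_edges G]>>%VS.

Definition ip0 (x y : chain0) : R := \sum_v x v * y v.
Definition ip1 (G : wgraph) (x y : chain1) : R :=
  \sum_(p in oriented_edges G) (weight G [set p.1; p.2]%SET)^-1 * (x p * y p).

Definition boundary_fun (G : wgraph) (c : chain1) : chain0 :=
  \sum_(p in oriented_edges G) c p *: (vertex_chain p.2 - vertex_chain p.1).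

Lemma boundary_fun_linear G : linear (boundary_fun G).
Proof.
move=> a x y; rewrite /boundary_fun scaler_sumr -big_split /=.
by apply: eq_bigr => p _; rewrite !ffunE scalerDl scalerA.
Qed.

HB.instance Definition _ G :=
  GRing.isLinear.Build R chain1 chain0 *:%R (boundary_fun G)
    (boundary_fun_linear G).

Definition boundary (G : wgraph) : 'Hom(chain1, chain0) :=
  linfun (boundary_fun G).

Lemma boundary_edge G p : p \in oriented_edges G ->
  boundary G (edge_chain p) = vertex_chain p.2 - vertex_chain p.1.
Proof.
move=> pG; rewrite lfunE /= /boundary_fun (bigD1 p) //= big1 ?addr0.
  by rewrite ffunE eqxx scale1r.
by move=> q /andP[_ /negPf qp]; rewrite ffunE qp scale0r.
Qed.

Definition C1_rel (K L : wgraph) : {vspace chain1} :=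
  (C1 L :&: boundary L @^-1: C0 K)%VS.

Definition boundary_rel (K L : wgraph) :
    'Hom(subvs_of (C1_rel K L), subvs_of (C0 K)) :=
  (linfun (vsproj (C0 K)) \o boundary L \o linfun vsval)%VF.

Lemma boundary_relE K L (c : subvs_of (C1_rel K L)) :
  vsval (boundary_rel K L c) = boundary L (vsval c).
Proof.
have cK : boundary L (vsval c) \in C0 K.
  by have := subvsP c; rewrite memv_cap memv_preim => /andP[].
rewrite /boundary_rel !comp_lfunE (lfunE vsval) (lfunE (vsproj _)) /=.
exact: vsprojK.
Qed.

Definition ip0_sub (K : wgraph) (x y : subvs_of (C0 K)) : R :=
  ip0 (vsval x) (vsval y).
Definition ip1_rel (K L : wgraph) (x y : subvs_of (C1_rel K L)) : R :=
  ip1 L (vsval x) (vsval y).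

Definition persistent_laplacian0 (K L : wgraph) : 'End(subvs_of (C0 K)) :=
  (boundary_rel K L \o
   adjoint (@ip1_rel K L) (@ip0_sub K) (boundary_rel K L))%VF.

Lemma C1_supp G c p : c \in C1 G -> p \notin oriented_edges G -> c p = 0.
Proof.
move=> cG pG; set X := [seq edge_chain q | q in oriented_edges G].
rewrite (coord_span (X := in_tuple X) cG).
rewrite sum_ffunE big1 // => i _; rewrite ffunE.
have /fintype.imageP[q qG ->] : (in_tuple X)`_i \in X by rewrite mem_nth.
rewrite ffunE; case: eqP => [pq|_]; last by rewrite scaler0.
by rewrite pq qG in pG.
Qed.

Lemma ip0C x y : ip0 x y = ip0 y x.
Proof. by apply: eq_bigr => v _; rewrite mulrC. Qed.

Lemma ip1C G x y : ip1 G x y = ip1 G y x.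
Proof. by apply: eq_bigr => p _; rewrite (mulrC (x p)). Qed.

Lemma ip0P y : linear (fun x => ip0 x y : R^o).
Proof.
move=> a u v; rewrite /ip0 scaler_sumr -big_split /=.
by apply: eq_bigr => w _; rewrite !ffunE mulrDl -mulrA.
Qed.

Lemma ip1P G y : linear (fun x => ip1 G x y : R^o).
Proof.
move=> a u v; rewrite /ip1 scaler_sumr -big_split /=.
apply: eq_bigr => p _; rewrite !ffunE mulrDl mulrDr; congr (_ + _).
by rewrite -[(a *: _) * _]mulrA mulrCA.
Qed.

Lemma boundary_rel_adjointP K L :
  is_adjoint (@ip1_rel K L) (@ip0_sub K) (boundary_rel K L)
    (adjoint (@ip1_rel K L) (@ip0_sub K) (boundary_rel K L)).
Proof.
apply: adjointP.
- by move=> y a u v; rewrite /ip1_rel -ip1P.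
- by move=> x a u v; rewrite /ip1_rel !(ip1C _ (vsval x)) -ip1P.
- move=> x; rewrite /ip1_rel /ip1 => /eqP; rewrite psumr_eq0; last first.
    move=> p; rewrite inE => /andP[_ /weight_gt0 w0].
    by rewrite mulr_ge0 ?invr_ge0 ?(ltW w0) // -expr2 sqr_ge0.
  move=> /allP x0; apply: val_inj; apply/ffunP => p; rewrite [RHS]ffunE.
  have [pL|pL] := boolP (p \in oriented_edges L); last first.
    by apply: C1_supp pL; have := subvsP x; rewrite memv_cap => /andP[].
  have := x0 p; rewrite mem_index_enum pL => /(_ isT) /=.
  move: (pL); rewrite inE => /andP[_ /weight_gt0 /lt0r_neq0 w0].
  by rewrite mulf_eq0 invr_eq0 (negPf w0) /= -expr2 sqrf_eq0 => /eqP.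
- by move=> y a u v; rewrite /ip0_sub -ip0P.
- by move=> x a u v; rewrite /ip0_sub !(ip0C (vsval x)) -ip0P.
Qed.

(* [k] counts from 1. *)
Definition lambda0 (K L : wgraph) (k : nat) : R :=
  kth_eigenvalue (persistent_laplacian0 K L) k.

End WeightedGraphs.

(* Main.v *)
Require Import Defs.
From mathcomp Require Import all_boot all_order all_algebra.
From mathcomp Require Import reals.
From mathcomp Require Import ring lra zify complex.
Import Order.TTheory GRing.Theory Num.Theory.
Local Open Scope ring_scope.

Set Implicit Arguments.
Unset Strict Implicit.
Unset Printing Implicit Defensive.

(** Write [J] for the vertex set of [K] and [S] for the Schur complement of the
    Laplacian of [L] onto [J].  The theorem is Cheeger's inequality for a single
    weighted graph, the Kron reduction of [L] onto [J], because all three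
    quantities in it can be read off from [S].

    The bridge is harmonic extension.  A function [f] on [J] extends to a
    function [x] on the vertices of [L] whose Laplacian vanishes outside [J],
    and the Laplacian of [x] restricted to [J] is [S f] ([harmonic_extension]).
    On the chain side, the current of [x], which is the weighted gradient of
    [x], is then a relative 1-chain, it represents the adjoint of the boundary
    map at [f], and its boundary is [S f].  Hence the persistent Laplacian acts
    as [S] ([persistent_laplacian0_schur]), and [lambda0 K L 2] is the second
    root of the characteristic polynomial of [S].  The effective conductance of
    a subset of [J] is by definition the quadratic form of [S] at an indicator.

    By Dirichlet's principle the quadratic form of [S] at [f] is the least
    energy in [L] of an extension of [f] ([dirichlet]).  Comparing energies
    shows that [S] is the Laplacian of a graph on [J] with nonnegative weights:
    its rows sum to zero, it is positive semidefinite, its entries off the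
    diagonal are nonpositive (taking absolute values does not increase energy),
    and its diagonal entries are at most the degrees in [L].

    For such a matrix the two inequalities are classical.  The second
    eigenvalue is the minimum of the Rayleigh quotient on the orthogonal
    complement of the constants ([second_eigenvalue], from an orthogonal
    diagonalization of [S]).  An indicator projected onto that complement gives
    the upper bound, since a set of at most half the vertices loses at most half
    of its squared norm in the projection.  The lower bound
    ([weighted_cheeger]) splits a function at a median into two nonnegative
    parts, each supported on at most half of the vertices, and combines the
    coarea inequality for the square of each part with the Cauchy-Schwarz
    inequality. *)

(** * Cheeger's inequality for a weighted finite set *)

Section WeightedCheeger.
Variables (R : realFieldType) (I : finType) (w : I -> I -> R) (h dm : R).
Hypothesis w_ge0 : forall i j, 0 <= w i j.
Hypothesis wC : forall i j, w i j = w j i.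
Hypothesis w_deg : forall i, \sum_j w i j <= dm.
Hypothesis dm_ge0 : 0 <= dm.
Hypothesis h_ge0 : 0 <= h.
Hypothesis h_iso : forall A : {set I}, (2 * #|A| <= #|I|)%N ->
  h * #|A|%:R <= \sum_(i in A) \sum_(j in ~: A) w i j.

(** Each pair split by [A] is seen once from each side, whence the factor 2. *)
Lemma cut_variation (A : {set I}) :
  \sum_i \sum_j w i j * `|(i \in A)%:R - (j \in A)%:R|
  = 2 * \sum_(i in A) \sum_(j in ~: A) w i j.
Proof.
have -> : \sum_i \sum_j w i j * `|(i \in A)%:R - (j \in A)%:R| =
   \sum_(i in A) \sum_(j in ~: A) w i j + \sum_(j in A) \sum_(i in ~: A) w i j.
  rewrite (bigID (mem A)) /=; congr (_ + _).
    apply: eq_bigr => i iA; rewrite [RHS]big_mkcond /=.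
    apply: eq_bigr => j _; rewrite iA !inE.
    by case: (j \in A); rewrite /= ?subrr ?subr0 ?normr0 ?mulr0 ?normr1 ?mulr1.
  rewrite exchange_big [LHS](bigID (mem A)) /= [X in _ + X]big1 ?addr0 => [|j jA].
    apply: eq_bigr => j jA; rewrite [RHS]big_mkcond [LHS]big_mkcond /=.
    apply: eq_bigr => i _; rewrite jA !inE.
    by case: (i \in A); rewrite //= sub0r normrN1 mulr1.
  by rewrite big1 // => i iA; rewrite (negPf iA) (negPf jA) subrr normr0 mulr0.
have -> : \sum_(j in A) \sum_(i in ~: A) w i j = \sum_(i in A) \sum_(j in ~: A) w i j.
  by apply: eq_bigr => j _; apply: eq_bigr => i _; rewrite wC.
by ring.
Qed.

(** The level sets of [phi] all have at most half of the points, so the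
    isoperimetric hypothesis applies to each.  The integral over levels is
    replaced by an induction on the support: subtracting the least nonzero value
    [m] on the support removes [m] times the variation of one indicator and
    shrinks the support. *)
Lemma coarea (phi : I -> R) : (forall i, 0 <= phi i) ->
  (2 * #|[set i | (phi i != 0)%R]| <= #|I|)%N ->
  2 * h * \sum_i phi i <= \sum_i \sum_j w i j * `|phi i - phi j|.
Proof.
have [k] := ubnP #|[set i | (phi i != 0)%R]|.
elim: k phi => // k IH phi; set A := [set i | phi i != 0].
rewrite ltnS => Ak phi_ge0 A_half.
have phiA i : (i \in A) = (phi i != 0) by rewrite inE.
have phi0 i : i \notin A -> phi i = 0 by rewrite phiA negbK => /eqP.
have [A0|[a aA]] := set_0Vmem A.
  rewrite big1 ?mulr0 => [|i _]; last by rewrite phi0 // A0 inE.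
  by apply: sumr_ge0 => i _; apply: sumr_ge0 => j _; rewrite mulr_ge0.
pose m := phi [arg min_(i < a in A) phi i]%O.
have [mA m_min] : [arg min_(i < a in A) phi i]%O \in A /\
    forall i, i \in A -> m <= phi i.
  by rewrite /m; case: arg_minP.
pose psi i := phi i - m * (i \in A)%:R.
have psi_ge0 i : 0 <= psi i.
  rewrite /psi; case: (boolP (i \in A)) => [/m_min|_]; last by rewrite mulr0 subr0.
  by rewrite mulr1 subr_ge0.
have psiA : [set i | psi i != 0] \proper A.
  apply/properP; split.
    apply/subsetP => i; rewrite !inE; apply: contra => /eqP i0.
    by rewrite /psi phiA i0 eqxx mulr0 subr0.
  by exists [arg min_(i < a in A) phi i]%O => //; rewrite inE /psi mA mulr1 subrr eqxx.
have m_ge0 : 0 <= m by apply: phi_ge0.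
(* Subtracting [m] on [A] keeps the order of the values, so the variation splits. *)
have var i j : `|phi i - phi j| =
    `|psi i - psi j| + m * `|(i \in A)%:R - (j \in A)%:R|.
  rewrite /psi; case: (boolP (i \in A)) (@m_min i) (phi0 i) => iA /= mi pi;
    case: (boolP (j \in A)) (@m_min j) (phi0 j) => jA /= mj pj.
  - by rewrite subrr normr0 mulr0 addr0; congr `|_|; ring.
  - rewrite pj // !(mulr0, subr0, mulr1, normr1) !ger0_norm ?subrK //.
      by rewrite subr_ge0 mi.
  - rewrite pi // mulr1 mulr0 subrr !sub0r !normrN normr1 mulr1 !ger0_norm ?subrK //.
      by rewrite subr_ge0 mj.
  - by rewrite subrr normr0 !mulr0 addr0 !subr0.
have {IH} IHpsi := IH psi (leq_trans (proper_card psiA) Ak) psi_ge0 _.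
have {}IHpsi : 2 * h * \sum_i psi i <= \sum_i \sum_j w i j * `|psi i - psi j|.
  by apply: IHpsi; rewrite (leq_trans _ A_half) // leq_mul2l /= ltnW // proper_card.
have -> : \sum_i phi i = \sum_i psi i + m * #|A|%:R.
  rewrite -sum1_card natr_sum mulr_sumr [X in _ + X]big_mkcond -big_split /=.
  by apply: eq_bigr => i _; rewrite /psi; case: (i \in A); rewrite ?mulr1 ?mulr0 ?subrK ?subr0 ?addr0.
have -> : \sum_i \sum_j w i j * `|phi i - phi j| =
    \sum_i \sum_j w i j * `|psi i - psi j| +
    m * (2 * \sum_(i in A) \sum_(j in ~: A) w i j).
  rewrite -cut_variation mulr_sumr -big_split; apply: eq_bigr => i _ /=.
  rewrite mulr_sumr -big_split; apply: eq_bigr => j _ /=.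
  by rewrite var mulrDr mulrCA.
rewrite mulrDr lerD //.
have := h_iso A_half; set c := \sum_(i in A) _ => hc.
have -> : 2 * h * (m * #|A|%:R) = m * (2 * (h * #|A|%:R)) by ring.
by rewrite ler_wpM2l // ler_wpM2l.
Qed.

Lemma discrete_cauchy_schwarz (J : finType) (v x y : J -> R) :
  (forall j, 0 <= v j) ->
  (\sum_j v j * (x j * y j)) ^+ 2
  <= (\sum_j v j * x j ^+ 2) * (\sum_j v j * y j ^+ 2).
Proof.
move=> v_ge0.
set b := \sum_j _; set p := \sum_j _; set q := \sum_j _.
have form a c : 0 <= a ^+ 2 * p - 2 * (a * c) * b + c ^+ 2 * q.
  suff -> : a ^+ 2 * p - 2 * (a * c) * b + c ^+ 2 * q =
      \sum_j v j * (a * x j - c * y j) ^+ 2.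
    by apply: sumr_ge0 => j _; rewrite mulr_ge0 // sqr_ge0.
  rewrite !mulr_sumr -sumrN -!big_split /=; apply: eq_bigr => j _; ring.
have q_ge0 : 0 <= q by apply: sumr_ge0 => j _; rewrite mulr_ge0 // sqr_ge0.
have [q0|q_neq0] := eqVneq q 0.
  (* Without its square term the form is affine in c; for b != 0 this c makes
     it -1. *)
  have := form 1 ((p + 1) / (2 * b)); rewrite q0 !mulr0.
  have [->|b0] := eqVneq b 0; first by rewrite expr0n.
  have -> : 1 ^+ 2 * p - 2 * (1 * ((p + 1) / (2 * b))) * b + 0 = -1 by field.
  by rewrite oppr_ge0 ler10.
have q_gt0 : 0 < q by rewrite lt_def q_neq0.
(* For fixed a the form is least at c = a * b / q. *)
have := form q b.
have -> : q ^+ 2 * p - 2 * (q * b) * b + b ^+ 2 * q = q * (p * q - b ^+ 2) by ring.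
by rewrite pmulr_rge0 // subr_ge0.
Qed.

(** Cauchy-Schwarz applied to the factorization
    [g i ^+ 2 - g j ^+ 2 = (g i - g j) * (g i + g j)] of the variation of the
    square; the second factor costs at most [4 * dm] times the squared norm. *)
Lemma half_support_bound (g : I -> R) : (forall i, 0 <= g i) ->
  (2 * #|[set i | (g i != 0)%R]| <= #|I|)%N ->
  h ^+ 2 * \sum_i g i ^+ 2 <= dm * \sum_i \sum_j w i j * (g i - g j) ^+ 2.
Proof.
move=> g_ge0 g_half; set N := \sum_i g i ^+ 2; set E := \sum_i \sum_j _.
have N_ge0 : 0 <= N by apply: sumr_ge0 => i _; exact: sqr_ge0.
have E_ge0 : 0 <= E.
  by apply: sumr_ge0 => i _; apply: sumr_ge0 => j _; rewrite mulr_ge0 ?sqr_ge0.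
have [N0|N_neq0] := eqVneq N 0; first by rewrite N0 mulr0 mulr_ge0.
have N_gt0 : 0 < N by rewrite lt_def N_neq0.
pose F := \sum_i \sum_j w i j * (g i + g j) ^+ 2.
have F_le : F <= 4 * dm * N.
  have row i : \sum_j w i j * (g i ^+ 2) <= dm * g i ^+ 2.
    by rewrite -mulr_suml ler_wpM2r ?sqr_ge0.
  have rows : \sum_i \sum_j w i j * (g i ^+ 2) <= dm * N.
    by rewrite mulr_sumr ler_sum.
  have cols : \sum_i \sum_j w i j * (g j ^+ 2) <= dm * N.
    rewrite exchange_big mulr_sumr ler_sum // => j _; apply: le_trans (row j).
    by rewrite ler_sum // => i _; rewrite wC.
  have : F <= 2 * (\sum_i \sum_j w i j * (g i ^+ 2) + \sum_i \sum_j w i j * (g j ^+ 2)).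
    rewrite -big_split mulr_sumr ler_sum // => i _ /=.
    rewrite -big_split mulr_sumr ler_sum // => j _ /=.
    by have := sqr_ge0 (g i - g j); have := w_ge0 i j; nra.
  by lra.
have E_F : (2 * h * N) ^+ 2 <= E * F.
  have cs := @discrete_cauchy_schwarz (I * I)%type (fun p => w p.1 p.2)
    (fun p => `|g p.1 - g p.2|) (fun p => g p.1 + g p.2) (fun p => w_ge0 _ _).
  rewrite /E /F !pair_big /=.
  under [X in _ <= X * _]eq_bigr do rewrite -real_normK ?num_real //.
  apply: le_trans cs.
  have g2 i : g i ^+ 2 != 0 = (g i != 0) by rewrite sqrf_eq0.
  have := @coarea (fun i => g i ^+ 2) (fun i => sqr_ge0 _).
  rewrite (_ : [set i | g i ^+ 2 != 0] = [set i | g i != 0]); last first.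
    by apply/setP => i; rewrite !inE g2.
  move=> /(_ g_half); rewrite pair_big /= => le_sum.
  rewrite ler_sqr ?nnegrE ?mulr_ge0 //; last first.
    by apply: sumr_ge0 => p _; rewrite !mulr_ge0 ?addr_ge0.
  apply: le_trans le_sum _; apply: ler_sum => p _.
  by rewrite subr_sqr normrM (ger0_norm (addr_ge0 (g_ge0 p.1) (g_ge0 p.2))).
have : 4 * N * (h ^+ 2 * N) <= 4 * N * (dm * E).
  by have := ler_wpM2l E_ge0 F_le; move: E_F; lra.
by rewrite ler_pM2l // mulr_gt0.
Qed.

(** Take the least value of [f] with at most half of the points strictly above
    it. *)
Lemma exists_median (f : I -> R) (i0 : I) : exists m,
  (2 * #|[set i | (m < f i)%R]| <= #|I|)%N /\
  (2 * #|[set i | (f i < m)%R]| <= #|I|)%N.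
Proof.
pose P i := (2 * #|[set j | (f i < f j)%R]| <= #|I|)%N.
have P0 : P [arg max_(i > i0) f i]%O.
  rewrite /P; case: arg_maxP => // k _ k_max.
  rewrite (_ : [set j | _] = set0) ?cards0 //; apply/setP => j; rewrite !inE.
  by apply/negbTE; rewrite -leNgt; exact: k_max.
case: (@arg_minP _ _ _ _ P f P0) => k Pk k_min; exists (f k); split => //.
rewrite leqNgt; apply/negP => big.
have /set0Pn[j1 j1k] : [set i | (f i < f k)%R] != set0.
  by apply/negP => /eqP e; rewrite e cards0 in big.
(* The largest value below the median would be an earlier candidate. *)
case: (@arg_maxP _ _ _ _ (fun i => i \in [set i | (f i < f k)%R]) f j1k) => j jk j_max.
have : P j.
  rewrite /P (_ : [set i | (f j < f i)%R] = ~: [set i | (f i < f k)%R]).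
    by rewrite [#|~: _|]cardsCs setCK; lia.
  apply/setP => i; rewrite !inE -leNgt; apply/idP/idP => [ji|].
    by rewrite leNgt; apply/negP => ik; have /= := j_max i; rewrite inE ik leNgt ji => /(_ isT).
  by apply: lt_le_trans; move: jk; rewrite inE.
by move=> /k_min; rewrite leNgt; move: jk; rewrite inE => ->.
Qed.

(** Splitting at a median [m] produces two functions of at most half support.
    Shifting by [m] can only increase the squared norm because [f] has mean
    zero, and the squared differences of the two parts add up to at most those
    of [f]. *)
Theorem weighted_cheeger (f : I -> R) : \sum_i f i = 0 ->
  h ^+ 2 * \sum_i f i ^+ 2 <= dm * \sum_i \sum_j w i j * (f i - f j) ^+ 2.
Proof.
move=> f0; have [i0 _|noI] := pickP (mem I); last first.
  by rewrite !big_pred0 ?mulr0 // => i; have := noI i; rewrite inE.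
have [m [m_up m_down]] := exists_median f i0.
pose g i := Num.max (f i - m) 0; pose k i := Num.max (m - f i) 0.
have g_ge0 i : 0 <= g i by rewrite /g le_max lexx orbT.
have k_ge0 i : 0 <= k i by rewrite /k le_max lexx orbT.
have gk i : (g i = f i - m /\ k i = 0) \/ (g i = 0 /\ k i = m - f i).
  rewrite /g /k; have [fm|fm] := leP m (f i).
    by left; rewrite max_l ?max_r ?subr_ge0 ?subr_le0.
  by right; rewrite max_r ?max_l ?subr_ge0 ?subr_le0 // ltW.
have g_half : (2 * #|[set i | (g i != 0)%R]| <= #|I|)%N.
  rewrite (_ : [set i | _] = [set i | (m < f i)%R]) //; apply/setP => i.
  rewrite !inE /g -subr_gt0; by case: ltP => [/gt_eqF ->|]; rewrite ?eqxx.
have k_half : (2 * #|[set i | (k i != 0)%R]| <= #|I|)%N.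
  rewrite (_ : [set i | _] = [set i | (f i < m)%R]) //; apply/setP => i.
  rewrite !inE /k -subr_gt0; by case: ltP => [/gt_eqF ->|]; rewrite ?eqxx.
have norm_le : \sum_i f i ^+ 2 <= \sum_i g i ^+ 2 + \sum_i k i ^+ 2.
  rewrite -big_split /=.
  have -> : \sum_i (g i ^+ 2 + k i ^+ 2) = \sum_i f i ^+ 2 + \sum_(i : I) m ^+ 2.
    have <- : \sum_i f i ^+ 2 + \sum_(i : I) m ^+ 2 - 2 * m * \sum_i f i = \sum_i f i ^+ 2 + \sum_(i : I) m ^+ 2.
      by rewrite f0 mulr0 subr0.
    rewrite mulr_sumr -sumrN -!big_split /=; apply: eq_bigr => i _.
    by case: (gk i) => -[-> ->]; ring.
  by rewrite lerDl sumr_ge0 // => i _; exact: sqr_ge0.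
have var_le : \sum_i \sum_j w i j * (g i - g j) ^+ 2
    + \sum_i \sum_j w i j * (k i - k j) ^+ 2
    <= \sum_i \sum_j w i j * (f i - f j) ^+ 2.
  rewrite -big_split ler_sum // => i _ /=; rewrite -big_split ler_sum // => j _ /=.
  rewrite -mulrDr ler_wpM2l //.
  have := (g_ge0 i, g_ge0 j, (k_ge0 i, k_ge0 j)).
  by case: (gk i) => -[-> ->]; case: (gk j) => -[-> ->] [[? ?] [? ?]]; nra.
have := half_support_bound g_ge0 g_half; have := half_support_bound k_ge0 k_half.
have := ler_wpM2l (sqr_ge0 h) norm_le; have := ler_wpM2l dm_ge0 var_le.
by rewrite !mulrDr; lra.
Qed.
End WeightedCheeger.

(** * Symmetric real matrices and their second eigenvalue *)

(** Over the complex numbers the matrix becomes Hermitian, hence unitarily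
    diagonalizable with real eigenvalues; a real root of the complex
    characteristic polynomial is a root of the real one. *)
Lemma symmetric_eigenvalue (R : rcfType) n (S : 'M[R]_n.+1) :
  S^T = S -> exists a, eigenvalue S a.
Proof.
move=> S_sym; pose Sc := map_mx (real_complex R) S.
have Sc_herm : Sc \is hermsymmx.
  apply: realsym_hermsym.
    by apply/is_hermitianmxP; rewrite expr0 scale1r map_mx_id // map_trmx S_sym.
  by apply/mxOverP => i j; rewrite mxE complex_real.
have /orthomx_spectralP := hermitian_normalmx Sc_herm.
set P := spectralmx Sc; set D := spectral_diag Sc => ScE.
have P_unit : P \in unitmx by exact: spectral_unit.
have D_real : D 0 0 \is Num.real.
  by have /mxOverP := hermitian_spectral_diag_real Sc_herm; apply.
have [a Da] : exists a, D 0 0 = real_complex R a.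
  by exists (complex.Re (D 0 0)); rewrite RRe_real.
exists a.
rewrite eigenvalue_root_char -(fmorph_root (real_complex R)) map_char_poly.
rewrite -eigenvalue_root_char /= -Da; apply/eigenvalueP.
exists (row 0 P); last first.
  apply/negP => /eqP P0; have := mulmxV P_unit => /(congr1 (row 0)).
  rewrite row_mul P0 mul0mx => /rowP/(_ 0); rewrite !mxE => /esym/eqP.
  by rewrite oner_eq0.
rewrite -/Sc {1}ScE -row_mul !mulmxA mulmxV // mul1mx.
by apply/rowP => j; rewrite !mxE (bigD1 0) //= big1 ?addr0 ?mxE ?eqxx // => k k0;
   rewrite !mxE eq_sym (negPf k0) mulr0n mul0r.
Qed.

(** The reflection exchanging the first axis with the direction of [u]; when
    these already agree, the hyperplane of the reflection is not defined and the
    identity serves. *)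
Lemma householder (R : rcfType) n (u : 'rV[R]_n.+1) : u != 0 ->
  exists Q : 'M[R]_n.+1, exists2 c, c != 0 &
    Q *m Q^T = 1%:M /\ delta_mx 0 0 *m Q = c *: u.
Proof.
move=> u_neq0; pose dot (x y : 'rV[R]_n.+1) := (x *m y^T) 0 0.
have dotE x y : x *m y^T = (dot x y)%:M by exact: mx11_scalar.
have dotC x y : dot x y = dot y x.
  by rewrite /dot -(trmxK (y *m x^T)) trmx_mul trmxK [RHS]mxE.
have dotBl x y t : dot (x - y) t = dot x t - dot y t.
  by rewrite /dot mulmxBl [LHS]mxE [X in _ + X]mxE.
have dotZl k x y : dot (k *: x) y = k * dot x y.
  by rewrite /dot -scalemxAl mxE.
have dot_gt0 x : x != 0 -> 0 < dot x x.
  have x2 i : 0 <= x 0 i * x^T i 0 by rewrite mxE -expr2 sqr_ge0.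
  move=> /rV0Pn[i xi]; rewrite lt_def /dot mxE sumr_ge0 // andbT psumr_eq0 //.
  apply/negP => /allP/(_ i); rewrite mem_index_enum mxE /= mulf_eq0 orbb => /(_ isT).
  by rewrite (negPf xi).
pose c := (Num.sqrt (dot u u))^-1; have c_neq0 : c != 0.
  by rewrite invr_eq0 gt_eqF // sqrtr_gt0 dot_gt0.
pose e : 'rV[R]_n.+1 := delta_mx 0 0; pose v := c *: u; pose z := e - v.
have vv : dot v v = 1.
  rewrite dotZl dotC dotZl mulrA -expr2 exprVn.
  by rewrite sqr_sqrtr ?mulVf ?gt_eqF ?dot_gt0 // ltW ?dot_gt0.
have ee : dot e e = 1 by rewrite /dot /e trmx_delta mul_delta_mx mxE.
have zl t : dot z t = dot e t - dot v t by exact: dotBl.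
have zz : dot z z = 2 * dot e z.
  by rewrite zl !(dotC _ z) !zl ee vv (dotC v e); ring.
exists (if z == 0 then 1%:M else 1%:M - (2 / dot z z) *: (z^T *m z)), c => //.
case: eqVneq => [z0|z_neq0].
  by rewrite trmx1 !mulmx1 -/v; split => //; apply/eqP; rewrite -subr_eq0 -/e -/z z0.
have z_gt0 := dot_gt0 _ z_neq0; set W := 1%:M - _.
have eW x : x *m W = x - (2 / dot z z * dot x z) *: z.
  by rewrite mulmxBr mulmx1 -scalemxAr mulmxA dotE mul_scalar_mx scalerA.
split; last first.
  by rewrite eW mulrAC -zz divff ?gt_eqF // scale1r subKr.
have -> : W^T = W by rewrite /W linearB /= trmx1 linearZ /= trmx_mul trmxK.
apply/row_matrixP => i; rewrite row1 rowE mulmxA !eW.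
have -> : dot (delta_mx 0 i - (2 / dot z z * dot (delta_mx 0 i) z) *: z) z
    = - dot (delta_mx 0 i) z.
  by rewrite dotBl dotZl; field; rewrite gt_eqF.
by rewrite mulrN scaleNr opprK subrK.
Qed.

(** Moving [u] to the first axis by an orthogonal matrix splits [S] into [a]
    and a symmetric block of smaller size, to which induction applies.
    Prescribing the first eigenvector is what later identifies the remaining
    eigenvectors as a basis of the orthogonal complement of [u]. *)
Lemma symmetric_diagonalization (R : rcfType) n (S : 'M[R]_n.+1) (u : 'rV_n.+1) a :
  S^T = S -> u != 0 -> u *m S = a *: u ->
  exists P : 'M[R]_n.+1, exists d : 'rV[R]_n.+1, exists2 c : R, c != 0 &
    [/\ P *m P^T = 1%:M, P *m S *m P^T = diag_mx d, d 0 0 = a &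
        delta_mx 0 0 *m P = c *: u].
Proof.
elim: n S u a => [|n IH] S u a S_sym u_neq0 uS.
  have [Q [c c_neq0 [QQ Qu]]] := householder u_neq0.
  exists Q, (const_mx a), c => //; split; rewrite ?mxE //.
  have -> : S = a%:M.
    have [k] := rV0Pn _ u_neq0; rewrite ord1 => u0.
    apply/matrixP => j l; rewrite !ord1 [RHS]mxE eqxx mulr1n.
    move/rowP: uS => /(_ 0); rewrite !mxE big_ord1 mulrC => e.
    by apply: (mulIf u0).
  by rewrite mul_mx_scalar -scalemxAl QQ diag_const_mx scalemx1.
have [Q [c c_neq0 [QQ Qu]]] := householder u_neq0.
pose B : 'M_(1 + n.+1) := Q *m S *m Q^T.
have B_sym : B^T = B by rewrite /B !trmx_mul trmxK S_sym mulmxA.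
have B_row : delta_mx 0 0 *m B = a *: delta_mx 0 0 :> 'rV[R]_(1 + n.+1).
  rewrite /B !mulmxA Qu -!scalemxAl uS -scalemxAl scalerA mulrC -scalerA scalemxAl.
  by rewrite -Qu -mulmxA QQ mulmx1.
have defB : Q *m S *m Q^T = B by [].
(* Opaque from here on: reading entries would otherwise unfold the product. *)
clearbody B; pose B' := drsubmx B.
have B0 j : B 0 j = a * (j == 0)%:R.
  by move/rowP: B_row => /(_ j); rewrite -rowE !mxE.
have BE : B = block_mx a%:M 0 0 B'.
  have l0 : lshift n.+1 0 = 0 :> 'I_(1 + n.+1) by exact: val_inj.
  have Bur : ursubmx B = 0 by apply/rowP => j; rewrite !mxE l0 B0 mulr0.
  rewrite -[LHS]submxK Bur -[dlsubmx B]trmxK trmx_dlsub B_sym Bur trmx0.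
  congr block_mx; rewrite [LHS]mx11_scalar; congr (_%:M).
  by rewrite !mxE l0 B0 mulr1.
have B'_sym : B'^T = B' by rewrite /B' trmx_drsub B_sym.
have [a' /eigenvalueP[u' u'B' u'_neq0]] := symmetric_eigenvalue B'_sym.
have [P' [d' [c' _ [PP' PBP' _ _]]]] := IH B' u' a' B'_sym u'_neq0 u'B'.
pose P1 : 'M[R]_(1 + n.+1) := block_mx 1%:M 0 0 P'.
have P1T : P1^T = block_mx 1%:M 0 0 P'^T.
  by rewrite /P1 tr_block_mx !trmx0 trmx1.
have PP1 : P1 *m P1^T = 1%:M.
  rewrite P1T mulmx_block !mulmx0 !mul0mx mulmx1 PP' !addr0 add0r.
  by rewrite -scalar_mx_block.
have PBP1 : P1 *m B *m P1^T = diag_mx (row_mx a%:M d').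
  rewrite P1T BE !mulmx_block !(mulmx0, mul0mx, mulmx1, mul1mx, addr0, add0r) PBP'.
  by rewrite diag_mx_row; congr block_mx; apply/matrixP => i j; rewrite !ord1 !mxE eqxx.
exists (P1 *m Q), (row_mx a%:M d'), c => //; split.
- by rewrite trmx_mul mulmxA -(mulmxA P1) QQ mulmx1; exact: PP1.
- by rewrite trmx_mul mulmxA -(mulmxA P1) -(mulmxA P1) defB; exact: PBP1.
- have l0 : (0 : 'I_n.+2) = lshift n.+1 (0 : 'I_1) by exact: val_inj.
  apply: etrans (congr1 (row_mx a%:M d' 0) l0) _.
  by apply: etrans (row_mxEl _ _ _ _) _; rewrite mxE eqxx.
- rewrite mulmxA -Qu; congr (_ *m Q).
  have e0 : delta_mx 0 0 = row_mx 1%:M 0 :> 'rV[R]_(1 + n.+1).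
    apply/rowP => j; rewrite -(splitK j); case: (split j) => k /=.
      by rewrite row_mxEl !mxE !ord1.
    by rewrite row_mxEr !mxE.
  have : (delta_mx 0 0 : 'rV[R]_(1 + n.+1)) *m P1 = delta_mx 0 0.
    by rewrite e0 mul_row_block mulmx1 !(mulmx0, mul0mx, addr0).
  by apply.
Qed.

(** Stated with possibly different sizes [m] and [n], because it is applied with
    one of them a dimension and the other a cardinal, which are equal only
    propositionally. *)
Lemma char_poly_conj (R : comNzRingType) m n (P : 'M[R]_(m, n)) (Q : 'M[R]_(n, m))
    (A : 'M[R]_n) : P *m Q = 1%:M -> Q *m P = 1%:M ->
  char_poly (P *m A *m Q) = char_poly A.
Proof.
move=> PQ QP; have mn : m = n.
  by apply/eqP; rewrite eqn_leq (mulmx1_min PQ) (mulmx1_min QP).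
move: P Q PQ QP; rewrite mn => P Q PQ QP.
pose p : 'M_(n, n) := map_mx polyC P; pose q : 'M_(n, n) := map_mx polyC Q.
have pq : p *m q = 1%:M by rewrite -map_mxM PQ map_mx1.
rewrite /char_poly (_ : char_poly_mx _ = p *m char_poly_mx A *m q).
  by rewrite !det_mulmx mulrAC -det_mulmx pq det1 mul1r.
rewrite /char_poly_mx !map_mxM mulmxBr mulmxBl; congr (_ - _).
by rewrite scalar_mxC -mulmxA pq mulmx1.
Qed.

(** Diagonalize [S] in an orthonormal basis that starts with the direction of
    [u].  As [S] is positive semidefinite, the eigenvalue 0 at [u] comes first in
    the sorted list, so the second entry is the least eigenvalue on the rest of
    the basis, which spans the orthogonal complement of [u]. *)
Lemma second_eigenvalue (R : rcfType) n (S : 'M[R]_n) (u : 'rV_n) (s : seq R) :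
  (1 < n)%N -> S^T = S -> u != 0 -> u *m S = 0 ->
  (forall f : 'rV_n, 0 <= (f *m S *m f^T) 0 0) ->
  sorted <=%R s -> char_poly S = \prod_(a <- s) ('X - a%:P) ->
  (forall f : 'rV_n, f *m u^T = 0 ->
     s`_1 * (f *m f^T) 0 0 <= (f *m S *m f^T) 0 0) /\
  (exists f : 'rV_n, [/\ f *m u^T = 0, 0 < (f *m f^T) 0 0 &
     (f *m S *m f^T) 0 0 = s`_1 * (f *m f^T) 0 0]).
Proof.
case: n S u => [|[|n]] S u // _.
move=> S_sym u_neq0 uS S_psd s_sorted charS.
have [|P [d [c c_neq0 [PP PSP d0 Pu]]]] := @symmetric_diagonalization _ _ S u 0 S_sym u_neq0.
  by rewrite uS scale0r.
have PtP : P^T *m P = 1%:M by exact: mulmx1C.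
have SE : S = P^T *m diag_mx d *m P.
  by rewrite -PSP !mulmxA PtP mul1mx -mulmxA PtP mulmx1.
have form f : (f *m S *m f^T) 0 0 = \sum_k d 0 k * (f *m P^T) 0 k ^+ 2.
  have -> : f *m S *m f^T = (f *m P^T) *m diag_mx d *m (f *m P^T)^T.
    by rewrite SE trmx_mul trmxK !mulmxA.
  rewrite mxE; apply: eq_bigr => k _.
  by rewrite mul_mx_diag [X in X * _]mxE [X in _ * X]mxE; ring.
have norm f : (f *m f^T) 0 0 = \sum_k (f *m P^T) 0 k ^+ 2.
  have -> : f *m f^T = (f *m P^T) *m (f *m P^T)^T.
    by rewrite trmx_mul trmxK mulmxA -(mulmxA f) PtP mulmx1.
  by rewrite mxE; apply: eq_bigr => k _; rewrite [X in _ * X]mxE expr2.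
have axisP k : delta_mx 0 k *m P *m P^T = delta_mx 0 k by rewrite -mulmxA PP mulmx1.
have axis_sum (F : 'I_n.+2 -> R) k :
    \sum_l F l * (delta_mx 0 k : 'rV[R]_n.+2) 0 l ^+ 2 = F k.
  rewrite (bigD1 k) //= big1 => [|l lk]; first by rewrite mxE !eqxx expr1n mulr1 addr0.
  by rewrite mxE (negPf lk) andbF expr0n mulr0.
have d_ge0 k : 0 <= d 0 k.
  by have := S_psd (delta_mx 0 k *m P); rewrite form axisP axis_sum.
have char_d : char_poly S = \prod_(k < n.+2) ('X - (d 0 k)%:P).
  rewrite -(char_poly_conj S PP PtP) PSP char_poly_trig ?diag_mx_is_trig //.
  by apply: eq_bigr => k _; rewrite mxE eqxx mulr1n.
pose t := [seq d 0 (lift 0 k) | k : 'I_n.+1].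
have s_perm : perm_eq s (0 :: t).
  apply: prod_XsubC_eq; rewrite -charS char_d big_ord_recl d0 big_cons; congr (_ * _).
  by rewrite /t big_image.
have t_ge0 a : a \in t -> 0 <= a by case/mapP => k _ ->.
have sE : s = 0 :: sort <=%R t.
  apply: le_sorted_eq => //.
    rewrite /= path_min_sorted ?sort_le_sorted //.
    by apply/allP => a; rewrite mem_sort => /t_ge0.
  by rewrite (perm_trans s_perm) // perm_cons perm_sym perm_sort.
have t_size : size t = n.+1 by rewrite size_image card_ord.
have s1t : s`_1 \in t.
  by rewrite sE /= -(mem_sort <=%R) mem_nth // size_sort t_size.
have s1_min a : a \in t -> s`_1 <= a.
  rewrite sE -(mem_sort <=%R) /= => at_.
  have := sort_le_sorted t; case: sort at_ => //= b r.
  rewrite inE => /orP[/eqP->//|ar].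
  by rewrite le_path_sortedE => /andP[/allP/(_ a ar)].
have orthoP f : f *m u^T = 0 -> (f *m P^T) 0 0 = 0.
  move=> fu; have : f *m P^T *m (delta_mx 0 0 : 'rV_n.+2)^T = 0.
    by rewrite -mulmxA -trmx_mul Pu linearZ /= -scalemxAr fu scaler0.
  by move/matrixP => /(_ 0 0); rewrite trmx_delta -colE !mxE.
split=> [f /orthoP f0|].
  rewrite norm form mulr_sumr ler_sum // => k _.
  case: (unliftP 0 k) => [l ->|->]; last by rewrite f0 expr0n !mulr0.
  by rewrite ler_wpM2r ?sqr_ge0 // s1_min // (image_f (fun k => d 0 (lift 0 k))).
case/mapP: s1t => k _ ->; exists (delta_mx 0 (lift 0 k) *m P); split.
- have : (delta_mx 0 (lift 0 k) : 'rV_n.+2) *m P *m ((delta_mx 0 0 : 'rV_n.+2) *m P)^T = 0.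
    rewrite trmx_mul trmx_delta mulmxA axisP mul_delta_mx_cond.
    by rewrite eq_sym (negPf (neq_lift _ _)) mulr0n.
  rewrite Pu linearZ /= -scalemxAr => /eqP.
  by rewrite scaler_eq0 (negPf c_neq0) => /eqP.
- rewrite norm axisP; have := axis_sum (fun=> 1) (lift 0 k).
  by under eq_bigr do rewrite mul1r; move=> ->.
- rewrite form norm axisP axis_sum; have := axis_sum (fun=> 1) (lift 0 k).
  by under eq_bigr do rewrite mul1r; move=> ->; rewrite mulr1.
Qed.

Lemma symmetric_char_poly_splits (R : rcfType) n (S : 'M[R]_n) : S^T = S ->
  exists s : seq R, sorted <=%R s /\ char_poly S = \prod_(a <- s) ('X - a%:P).
Proof.
case: n S => [|n] S S_sym.
  by exists [::]; rewrite big_nil /char_poly det_mx00.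
have [a /eigenvalueP[u uS u_neq0]] := symmetric_eigenvalue S_sym.
have [P [d [_ _ [PP PSP _ _]]]] := symmetric_diagonalization S_sym u_neq0 uS.
exists (sort <=%R [seq d 0 k | k : 'I_n.+1]); split; first exact: sort_le_sorted.
rewrite (perm_big _ (permEl (perm_sort _ _))) /= big_image /=.
rewrite -(char_poly_conj S PP (mulmx1C PP)) PSP char_poly_trig ?diag_mx_is_trig //.
by apply: eq_bigr => k _; rewrite mxE eqxx mulr1n.
Qed.

(** * Energy, harmonic extension and the Schur complement *)

Section Energy.
Variables (R : realType) (d : Order.disp_t) (T : finOrderType d) (G : wgraph R T).
Local Notation V := (vertices G).

(** Extending the weights by zero to all pairs of points turns sums over
    neighbours into sums over the whole type. *)
Definition conductivity (u v : T) : R :=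
  if [set u; v] \in edges G then weight G [set u; v] else 0.

Definition lap (x : T -> R) (u : T) : R :=
  \sum_v conductivity u v * (x u - x v).

(** The Dirichlet form; each edge occurs twice in the double sum, which the
    factor [2^-1] corrects. *)
Definition energy (x y : T -> R) : R :=
  2^-1 * \sum_u \sum_v conductivity u v * ((x u - x v) * (y u - y v)).

Lemma conductivityC u v : conductivity u v = conductivity v u.
Proof. by rewrite /conductivity setUC. Qed.

Lemma conductivity_ge0 u v : 0 <= conductivity u v.
Proof. by rewrite /conductivity; case: ifP => // /weight_gt0/ltW. Qed.

Lemma conductivity_diag u : conductivity u u = 0.
Proof.
rewrite /conductivity; case: ifP => // /edges_wf[].
by rewrite setUid cards1.
Qed.

Lemma conductivity_out u v : u \notin V -> conductivity u v = 0.
Proof.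
rewrite /conductivity => uV; case: ifP => // /edges_wf[_ /subsetP/(_ u)].
by rewrite !inE eqxx (negPf uV) => /(_ isT).
Qed.

Lemma lap_out x u : u \notin V -> lap x u = 0.
Proof. by move=> uV; apply: big1 => v _; rewrite conductivity_out // mul0r. Qed.

Lemma degE u : deg G u = \sum_v conductivity u v.
Proof.
rewrite /deg big_mkcond; apply: eq_bigr => v _ /=.
have [vV|vV] := boolP (v \in V) => /=; first by rewrite /conductivity; case: ifP.
by rewrite conductivityC conductivity_out.
Qed.

Lemma laplacian_entryE u v :
  laplacian_entry G u v = (u == v)%:R * deg G u - conductivity u v.
Proof.
rewrite /laplacian_entry; case: eqVneq => [->|_].
  by rewrite conductivity_diag subr0 mul1r.
by rewrite mul0r sub0r /conductivity; case: ifP; rewrite ?oppr0.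
Qed.

Lemma laplacian_entry_sum u x : u \in V ->
  \sum_(v in V) laplacian_entry G u v * x v = lap x u.
Proof.
move=> uV; under eq_bigr do rewrite laplacian_entryE mulrBl -mulrA.
rewrite sumrB (bigD1 u) //= eqxx mul1r big1 ?addr0; last first.
  by move=> v /andP[_ vu]; rewrite eq_sym (negPf vu) mul0r.
rewrite /lap; under [RHS]eq_bigr do rewrite mulrBr.
rewrite sumrB -mulr_suml -degE; congr (_ - _).
rewrite big_mkcond; apply: eq_bigr => v _; case: ifPn => // vV.
by rewrite conductivityC conductivity_out // mul0r.
Qed.

(** Discrete Green identity: summing over each edge from both of its ends turns
    one difference into a product of two. *)
Lemma green x y : \sum_u y u * lap x u = energy x y.
Proof.
have e1 : \sum_u y u * lap x u = \sum_u \sum_v conductivity u v * ((x u - x v) * y u).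
  apply: eq_bigr => u _; rewrite mulr_sumr; apply: eq_bigr => v _; ring.
have e2 : \sum_u y u * lap x u = \sum_u \sum_v conductivity u v * ((x v - x u) * y v).
  rewrite e1 exchange_big; apply: eq_bigr => u _; apply: eq_bigr => v _ /=.
  by rewrite conductivityC.
apply: (@mulfI _ 2); first by rewrite pnatr_eq0.
rewrite /energy mulrA divff ?pnatr_eq0 // mul1r mulrDl mul1r {1}e1 e2 -big_split.
apply: eq_bigr => u _; rewrite -big_split; apply: eq_bigr => v _ /=; ring.
Qed.

Lemma energyC x y : energy x y = energy y x.
Proof.
congr (_ * _); apply: eq_bigr => u _; apply: eq_bigr => v _.
by congr (_ * _); rewrite mulrC.
Qed.

Lemma energy_ge0 x : 0 <= energy x x.
Proof.
rewrite mulr_ge0 ?invr_ge0 //; apply: sumr_ge0 => u _; apply: sumr_ge0 => v _.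
by rewrite mulr_ge0 ?conductivity_ge0 // -expr2 sqr_ge0.
Qed.

(** Vanishing energy makes [x] constant along every edge. *)
Lemma energy_eq0 x : energy x x = 0 -> forall u, lap x u = 0.
Proof.
have t_ge0 u v : 0 <= conductivity u v * ((x u - x v) * (x u - x v)).
  by rewrite mulr_ge0 ?conductivity_ge0 // -expr2 sqr_ge0.
move=> /eqP; rewrite mulf_eq0 invr_eq0 pnatr_eq0 /= psumr_eq0; last first.
  by move=> u _; apply: sumr_ge0.
move=> /allP x0 u; have := x0 u; rewrite mem_index_enum psumr_eq0 // => /(_ isT).
move=> /allP x0u; apply: big1 => v _; have := x0u v; rewrite mem_index_enum.
move=> /(_ isT) /=; rewrite !mulf_eq0 orbb.
by case/orP => /eqP ->; rewrite ?mulr0 ?mul0r.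
Qed.

Lemma energy_contraction (x y : T -> R) :
  (forall u v, `|y u - y v| <= `|x u - x v|) -> energy y y <= energy x x.
Proof.
move=> xy; rewrite ler_wpM2l ?invr_ge0 // ler_sum // => u _; rewrite ler_sum // => v _.
rewrite ler_wpM2l ?conductivity_ge0 // -!expr2.
rewrite -[X in X <= _]real_normK ?num_real // -[X in _ <= X]real_normK ?num_real //.
by rewrite ler_sqr ?nnegrE ?normr_ge0.
Qed.

Definition restr (A : {set T}) (x : T -> R) : 'cV[R]_#|A| := \col_i x (enum_val i).

Lemma restr_surj (A : {set T}) (y : 'cV[R]_#|A|) :
  exists2 x, restr A x = y & forall u, u \notin A -> x u = 0.
Proof.
exists (fun u => \sum_i y i 0 * (u == enum_val i)%:R).
  apply/colP => i; rewrite mxE (bigD1 i) //= eqxx mulr1 big1 ?addr0 // => j ji.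
  by rewrite (inj_eq enum_val_inj) eq_sym (negPf ji) mulr0.
move=> u uA; apply: big1 => i _; case: eqVneq => [ui|_]; last by rewrite mulr0.
by rewrite ui enum_valP in uA.
Qed.

Lemma mul_laplacian_block (A B : {set T}) x :
  laplacian_block G A B *m restr B x
  = restr A (fun u => \sum_(v in B) laplacian_entry G u v * x v).
Proof.
apply/colP => i; rewrite !mxE [RHS]big_enum_val; apply: eq_bigr => j _.
by rewrite !mxE.
Qed.

Variable J : {set T}.
Hypothesis JV : J \subset V.
Local Notation Int := (V :\: J).

Lemma laplacian_block_split (A : {set T}) x : A \subset V ->
  laplacian_block G A J *m restr J x + laplacian_block G A Int *m restr Int x
  = restr A (lap x).
Proof.
move=> /subsetP AV; rewrite !mul_laplacian_block; apply/colP => i; rewrite !mxE.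
rewrite -laplacian_entry_sum ?AV ?enum_valP // [RHS](big_setID J) /=.
by rewrite (setIidPr JV).
Qed.

Lemma laplacian_blockT (A B : {set T}) :
  (laplacian_block G A B)^T = laplacian_block G B A.
Proof.
apply/matrixP => i j; rewrite !mxE !laplacian_entryE conductivityC eq_sym.
by congr (_ - _); case: eqVneq => [->|]; rewrite ?mul0r.
Qed.

(** The interior block may be singular, so solvability of the Dirichlet problem
    is a range condition.  It holds because a vector in the kernel of the
    interior block, extended by zero, has zero energy, hence zero Laplacian, and
    is therefore killed by the coupling block as well. *)
Lemma interior_range : exists D, laplacian_block G Int J = laplacian_block G Int Int *m D.
Proof.
have /submxP[D JD] : (laplacian_block G J Int <= laplacian_block G Int Int)%MS.
  rewrite submxE; apply/eqP/matrixP => i j.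
  set C := cokermx _; suff : laplacian_block G J Int *m col j C = 0.
    by move/colP => /(_ i); rewrite colE mulmxA -colE mxE [RHS]mxE => ->; rewrite mxE.
  have [g gC g0] := restr_surj (col j C); rewrite -gC.
  have J0 : restr J g = 0.
    by apply/colP => k; rewrite !mxE g0 // inE enum_valP.
  have lap_Int : restr Int (lap g) = 0.
    rewrite -laplacian_block_split ?subsetDl // J0 mulmx0 add0r gC colE mulmxA mulmx_coker.
    rewrite mul0mx.
    by apply/colP => k; rewrite !mxE.
  have lap0 : forall u, lap g u = 0.
    apply: energy_eq0; rewrite -green; apply: big1 => u _.
    have [uI|/g0 ->] := boolP (u \in Int); last by rewrite mul0r.
    move/colP: lap_Int => /(_ (enum_rank_in uI u)).
    by rewrite !mxE enum_rankK_in // => ->; rewrite mulr0.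
  have := laplacian_block_split g JV; rewrite J0 mulmx0 add0r => ->.
  by apply/colP => k; rewrite !mxE lap0.
exists D^T; rewrite -[LHS]laplacian_blockT JD trmx_mul.
by rewrite laplacian_blockT.
Qed.

(** Solving the interior equations with the Moore-Penrose inverse is exactly
    what the Schur complement records on [J]. *)
Lemma harmonic_extension (f : T -> R) : exists x,
  [/\ {in J, x =1 f}, {in Int, forall u, lap x u = 0} &
      restr J (lap x) = schur G J *m restr J f].
Proof.
set y := - (mpinv (laplacian_block G Int Int) *m laplacian_block G Int J *m restr J f).
have [g gy g0] := restr_surj y.
pose x u := if u \in J then f u else g u.
have xJ : restr J x = restr J f by apply/colP => i; rewrite !mxE /x enum_valP.
have xI : restr Int x = y.
  rewrite -gy; apply/colP => i; rewrite !mxE /x.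
  by have := enum_valP i; rewrite inE => /andP[/negPf ->].
have [D ID] := interior_range.
have /and4P[/eqP LXL _ _ _] := mpinvP (laplacian_block G Int Int).
exists x; split.
- by move=> u uJ; rewrite /x uJ.
- move=> u uI; have : restr Int (lap x) = 0.
    rewrite -laplacian_block_split ?subsetDl // xJ xI mulmxN !mulmxA.
    by rewrite {2}ID !mulmxA LXL -ID subrr.
  by move/colP => /(_ (enum_rank_in uI u)); rewrite !mxE enum_rankK_in.
- by rewrite -laplacian_block_split // xJ xI mulmxN !mulmxA /schur mulmxBl.
Qed.

Lemma restr_eq (f g : T -> R) : {in J, f =1 g} -> restr J f = restr J g.
Proof. by move=> fg; apply/colP => i; rewrite !mxE fg // enum_valP. Qed.

(** Since the Laplacian of [x] is concentrated on [J], pairing it with [y] only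
    sees the restriction of [y] to [J], whatever the extension [y] is. *)
Lemma schur_energy (f : T -> R) : exists x, [/\ {in J, x =1 f},
  restr J (lap x) = schur G J *m restr J f &
  forall y, ((restr J y)^T *m schur G J *m restr J f) 0 0 = energy x y].
Proof.
have [x [xf x_harm xS]] := harmonic_extension f; exists x; split=> // y.
rewrite -mulmxA -xS -green mxE [RHS](bigID (mem J)) /= [X in _ + X]big1 ?addr0.
  by rewrite [RHS]big_enum_val; apply: eq_bigr => i _; rewrite !mxE.
move=> u uJ; have [uV|uV] := boolP (u \in V); last by rewrite lap_out ?mulr0.
by rewrite x_harm ?mulr0 // inE uJ.
Qed.

Lemma energy_amgm x y : 2 * energy x y <= energy x x + energy y y.
Proof.
rewrite /energy -mulrDr mulrCA ler_wpM2l ?invr_ge0 //.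
rewrite mulr_sumr -big_split ler_sum // => u _ /=.
rewrite mulr_sumr -big_split ler_sum // => v _ /=.
have := conductivity_ge0 u v; have := sqr_ge0 ((x u - x v) - (y u - y v)); nra.
Qed.

(** With [x] the harmonic extension, [energy x z] equals [energy x x] for every
    other extension [z], so the arithmetic-geometric inequality between [x] and
    [z] gives the minimality of [x]. *)
Lemma dirichlet (f z : T -> R) : {in J, z =1 f} ->
  ((restr J f)^T *m schur G J *m restr J f) 0 0 <= energy z z.
Proof.
have [x [xf _ xS]] := schur_energy f => zf.
have := energy_amgm x z; rewrite -!xS (restr_eq xf) (restr_eq zf); lra.
Qed.

Lemma schur_energyE (f : T -> R) : exists2 x, {in J, x =1 f} &
  ((restr J f)^T *m schur G J *m restr J f) 0 0 = energy x x.
Proof.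
have [x [xf _ xS]] := schur_energy f; exists x => //.
by rewrite -xS (restr_eq xf).
Qed.

Definition point (v u : T) : R := (u == v)%:R.

Lemma restr_point i : restr J (point (enum_val i)) = delta_mx i 0.
Proof.
by apply/colP => j; rewrite !mxE /point (inj_eq enum_val_inj) andbT.
Qed.

Lemma form_point (S : 'M[R]_#|J|) i j :
  ((restr J (point (enum_val i)))^T *m S *m restr J (point (enum_val j))) 0 0 = S i j.
Proof. by rewrite !restr_point trmx_delta -rowE -colE !mxE. Qed.

Lemma schur_sym : (schur G J)^T = schur G J.
Proof.
apply/matrixP => i j; rewrite mxE -!(form_point (schur G J)).
have [x [xi _ xS]] := schur_energy (point (enum_val i)).
have [y [yj _ yS]] := schur_energy (point (enum_val j)).
by rewrite -(restr_eq yj) xS (restr_eq yj) -(restr_eq xi) yS energyC.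
Qed.

Lemma schur_ge0 (f : T -> R) :
  0 <= ((restr J f)^T *m schur G J *m restr J f) 0 0.
Proof. by have [x _ ->] := schur_energyE f; exact: energy_ge0. Qed.

Lemma schur_const : schur G J *m restr J (fun=> 1) = 0.
Proof.
have [x [x1 xS xE]] := schur_energy (fun=> 1).
suff x0 : energy x x = 0.
  by rewrite -xS; apply/colP => i; rewrite !mxE (energy_eq0 x0).
apply/eqP; rewrite eq_le energy_ge0 andbT -xE (restr_eq x1).
apply: le_trans (@dirichlet (fun=> 1) (fun=> 1) (fun _ _ => erefl)) _.
rewrite /energy big1 ?mulr0 // => u _; apply: big1 => v _.
by rewrite subrr !mulr0.
Qed.

(** Compare the quadratic form at the sum and at the difference of two unit
    vectors: the absolute value of the harmonic extension of the difference
    extends the sum and has no more energy, and the two forms differ by four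
    times the entry. *)
Lemma schur_offdiag i j : i != j -> schur G J i j <= 0.
Proof.
move=> ij; set a := point (enum_val i); set b := point (enum_val j).
pose D := fun u => a u - b u; pose N := fun u => a u + b u.
have vij : enum_val i != enum_val j by rewrite (inj_eq enum_val_inj).
have [x xD DE] := schur_energyE D.
have : ((restr J N)^T *m schur G J *m restr J N) 0 0
    <= ((restr J D)^T *m schur G J *m restr J D) 0 0.
  rewrite DE; apply: le_trans (@dirichlet N (fun u => `|x u|) _) _.
    move=> u uJ; rewrite xD // /D /N /a /b /point.
    case: (eqVneq u (enum_val i)) => [->|_]; first by rewrite (negPf vij) subr0 addr0 normr1.
    by rewrite sub0r add0r normrN normr_nat.
  by apply: energy_contraction => u v; exact: ler_dist_dist.
have expand (e : R) : ((restr J (fun u => a u + e * b u))^T *m schur G J *m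
     restr J (fun u => a u + e * b u)) 0 0
   = schur G J i i + e ^+ 2 * schur G J j j + 2 * e * schur G J i j.
  have -> : restr J (fun u => a u + e * b u) = delta_mx i 0 + e *: delta_mx j 0.
    by rewrite -!restr_point; apply/colP => k; rewrite !mxE.
  have sji : schur G J j i = schur G J i j by rewrite -[in LHS]schur_sym mxE.
  move: (schur G J) sji => S sji.
  rewrite [(_ + _)^T]linearD /= [(_ *: _)^T]linearZ /= !trmx_delta.
  rewrite !mulmxDl !mulmxDr -!scalemxAl -!scalemxAr -!rowE -!colE.
  by rewrite !mxE sji; ring.
have -> : restr J N = restr J (fun u => a u + 1 * b u).
  by apply: restr_eq => u _; rewrite mul1r.
have -> : restr J D = restr J (fun u => a u + (-1) * b u).
  by apply: restr_eq => u _; rewrite mulN1r.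
rewrite !expand; lra.
Qed.

(** The degree is the energy of a point mass, one of the extensions that compete
    in Dirichlet's principle. *)
Lemma schur_diag i : schur G J i i <= deg G (enum_val i).
Proof.
rewrite -(form_point (schur G J)); set a := point _.
apply: le_trans (@dirichlet a a (fun _ _ => erefl)) _.
rewrite -green (bigD1 (enum_val i)) //= big1 ?addr0 => [|u ui].
  rewrite {1}/a /point eqxx mul1r degE ler_sum // => v _.
  have := conductivity_ge0 (enum_val i) v.
  rewrite /a /point eqxx => c_ge0; rewrite ler_piMr //.
  by case: eqP; rewrite ?subr0 // subrr.
by rewrite {1}/a /point (negPf ui) mul0r.
Qed.
End Energy.

(** * The persistent Laplacian is the Schur complement *)

Section Chains.
Variables (R : realType) (d : Order.disp_t) (T : finOrderType d).
Implicit Type G : wgraph R T.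

Lemma C0_supp G (x : chain0 R T) v : x \in C0 G -> v \notin vertices G -> x v = 0.
Proof.
move=> xG vG; set X := [seq vertex_chain R u | u in vertices G].
rewrite (coord_span (X := in_tuple X) xG).
rewrite sum_ffunE big1 // => i _; rewrite ffunE.
have /fintype.imageP[q qG ->] : (in_tuple X)`_i \in X by rewrite mem_nth.
rewrite ffunE; case: eqP => [pq|_]; last by rewrite scaler0.
by rewrite pq qG in vG.
Qed.

Lemma mem_C0 G (x : chain0 R T) :
  (forall v, v \notin vertices G -> x v = 0) -> x \in C0 G.
Proof.
move=> x0; have -> : x = \sum_(v in vertices G) x v *: vertex_chain R v.
  apply/ffunP => u; rewrite sum_ffunE.
  have [uG|uG] := boolP (u \in vertices G).
    rewrite (bigD1 u) //= big1 ?addr0 => [|v /andP[_ vu]]; rewrite !ffunE.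
      by rewrite eqxx [RHS]mulr1.
    by rewrite eq_sym (negPf vu) [LHS]mulr0.
  rewrite x0 // big1 // => v vG; rewrite !ffunE.
  by case: eqP => [uv|_]; [rewrite uv vG in uG | exact: mulr0].
apply: memv_suml => v vG; apply/memvZ/memv_span.
exact: (image_f (fun v => vertex_chain R v)).
Qed.

Lemma mem_C1 G (c : chain1 R T) :
  (forall p, p \notin oriented_edges G -> c p = 0) -> c \in C1 G.
Proof.
move=> c0; have -> : c = \sum_(p in oriented_edges G) c p *: edge_chain R p.
  apply/ffunP => q; rewrite sum_ffunE.
  have [qG|qG] := boolP (q \in oriented_edges G).
    rewrite (bigD1 q) //= big1 ?addr0 => [|p /andP[_ pq]]; rewrite !ffunE.
      by rewrite eqxx [RHS]mulr1.
    by rewrite eq_sym (negPf pq) [LHS]mulr0.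
  rewrite c0 // big1 // => p pG; rewrite !ffunE.
  by case: eqP => [qp|_]; [rewrite qp pG in qG | exact: mulr0].
apply: memv_suml => p pG; apply/memvZ/memv_span.
exact: (image_f (fun p => edge_chain R p)).
Qed.

Lemma boundary_ip0 G (c : chain1 R T) (y : T -> R) :
  \sum_v boundary G c v * y v = \sum_(p in oriented_edges G) c p * (y p.2 - y p.1).
Proof.
rewrite lfunE /= /boundary_fun.
under eq_bigr do rewrite sum_ffunE mulr_suml.
rewrite exchange_big; apply: eq_bigr => p _ /=.
under eq_bigr do rewrite !ffunE.
have pick u : \sum_v (v == u)%:R * y v = y u.
  rewrite (bigD1 u) //= eqxx mul1r big1 ?addr0 // => v /negPf ->.
  by rewrite mul0r.
rewrite -(pick p.2) -(pick p.1) -sumrB mulr_sumr; apply: eq_bigr => v _.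
by rewrite -[_ *: _]/(_ * _) -mulrA mulrBl.
Qed.

(** The current driven by the potential [x]. *)
Definition current G (x : T -> R) : chain1 R T :=
  [ffun p => if p \in oriented_edges G
     then weight G [set p.1; p.2] * (x p.2 - x p.1) else 0].

(** A sum over oriented edges is half of the sum over all ordered pairs. *)
Lemma current_energy G (x y : T -> R) :
  \sum_(p in oriented_edges G) current G x p * (y p.2 - y p.1) = energy G x y.
Proof.
pose phi p := conductivity G p.1 p.2 * ((x p.1 - x p.2) * (y p.1 - y p.2)).
have phiC p : phi (p.2, p.1) = phi p by rewrite /phi conductivityC /=; ring.
have upper : \sum_(p in oriented_edges G) current G x p * (y p.2 - y p.1)
    = \sum_(p : T * T | (p.1 < p.2)%O) phi p.
  rewrite big_mkcond [RHS]big_mkcond; apply: eq_bigr => p _ /=.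
  rewrite ffunE; case: ifP => [pG|]; rewrite inE.
    move: (pG); rewrite inE /phi /conductivity => /andP[-> ->].
    by rewrite -(opprB (x p.2)) -(opprB (y p.2)) mulrNN [RHS]mulrA.
  by case: ltP => //= _ pG; rewrite /phi /conductivity pG mul0r.
have lower : \sum_(p : T * T | (p.2 < p.1)%O) phi p
    = \sum_(p : T * T | (p.1 < p.2)%O) phi p.
  rewrite (reindex_inj (h := fun p : T * T => (p.2, p.1))) /=.
    by apply: eq_bigr => p _; exact: phiC.
  by move=> [a b] [a' b'] [-> ->].
rewrite /energy pair_big /= -/phi upper.
have -> : \sum_p phi p = 2 * \sum_(p : T * T | (p.1 < p.2)%O) phi p.
  rewrite mulrDl mul1r -{2}lower (bigID (fun p : T * T => (p.1 < p.2)%O)) /=.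
  congr (_ + _); rewrite (bigID (fun p : T * T => (p.2 < p.1)%O)) /=.
  rewrite [X in _ + X]big1 ?addr0.
    apply: eq_bigl => p; case: ltgtP => //.
  move=> p; case: ltgtP => // p12 _; rewrite /phi p12 conductivity_diag mul0r //.
by rewrite mulrA mulVf ?mul1r // pnatr_eq0.
Qed.

Lemma boundary_current G (x : T -> R) v : boundary G (current G x) v = lap G x v.
Proof.
have pick (y : T -> R) : \sum_u y u * point R v u = y v.
  rewrite (bigD1 v) //= /point eqxx mulr1 big1 ?addr0 // => u /negPf ->.
  by rewrite mulr0.
rewrite -(pick (boundary G _)) boundary_ip0 current_energy -green.
by under eq_bigr do rewrite mulrC; rewrite pick.
Qed.

Lemma ip1_current G (c : chain1 R T) (x : T -> R) :
  ip1 G c (current G x) = \sum_(p in oriented_edges G) c p * (x p.2 - x p.1).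
Proof.
apply: eq_bigr => p pG; rewrite ffunE pG.
move: pG; rewrite inE => /andP[_ /weight_gt0 /lt0r_neq0 w0].
by rewrite mulrCA; congr (_ * _); rewrite mulKf.
Qed.

End Chains.

Section PersistentLaplacian.
Variables (R : realType) (d : Order.disp_t) (T : finOrderType d).
Variables (K L : wgraph R T).
Hypothesis KL : vertices K \subset vertices L.

Lemma ip1_rel_eq0 (z : subvs_of (C1_rel K L)) : ip1_rel z z = 0 -> z = 0.
Proof.
rewrite /ip1_rel /ip1 => /eqP; rewrite psumr_eq0; last first.
  move=> p; rewrite inE => /andP[_ /weight_gt0 w0].
  by rewrite mulr_ge0 ?invr_ge0 ?(ltW w0) // -expr2 sqr_ge0.
move=> /allP z0; apply: val_inj; apply/ffunP => p; rewrite [RHS]ffunE.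
have [pL|pL] := boolP (p \in oriented_edges L); last first.
  by apply: C1_supp pL; have := subvsP z; rewrite memv_cap => /andP[].
have := z0 p; rewrite mem_index_enum pL => /(_ isT) /=.
move: (pL); rewrite inE => /andP[_ /weight_gt0 /lt0r_neq0 w0].
by rewrite mulf_eq0 invr_eq0 (negPf w0) /= -expr2 sqrf_eq0 => /eqP.
Qed.

(** The current of the harmonic extension of [f] has no boundary outside [K], so
    it is a relative chain, and by summation by parts its inner product with any
    relative chain is the pairing of the boundary of that chain with [f]: it is
    the adjoint of the boundary at [f].  Its boundary is the Laplacian of the
    extension. *)
Lemma persistent_laplacian0_schur (f : subvs_of (C0 K)) :
  restr (vertices K) (val (persistent_laplacian0 K L f))
  = schur L (vertices K) *m restr (vertices K) (val f).
Proof.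
have [x [xf x_harm xS]] := harmonic_extension KL (val f).
have c_rel : current L x \in C1_rel K L.
  rewrite memv_cap -memv_preim; apply/andP; split.
    by apply: mem_C1 => p pL; rewrite ffunE (negPf pL).
  apply: mem_C0 => v vK; rewrite boundary_current.
  have [vL|vL] := boolP (v \in vertices L); last exact: lap_out.
  by rewrite x_harm // inE vK.
pose c : subvs_of (C1_rel K L) := Subvs c_rel.
have adj_c : adjoint (@ip1_rel _ _ _ K L) (@ip0_sub _ _ _ K) (boundary_rel K L) f = c.
  set g := adjoint _ _ _; apply/eqP; rewrite -subr_eq0; apply/eqP/ip1_rel_eq0.
  set z := g f - c.
  have ip1B (u : subvs_of (C1_rel K L)) a b : ip1_rel u (a - b) = ip1_rel u a - ip1_rel u b.
    rewrite /ip1_rel /ip1 -sumrB; apply: eq_bigr => p _.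
    by rewrite !ffunE /=; ring.
  rewrite [in X in ip1_rel _ X]/z ip1B -(boundary_rel_adjointP z f).
  rewrite /ip0_sub /ip0 boundary_relE /ip1_rel ip1_current -boundary_ip0 -sumrB.
  apply: big1 => v _; have [vK|vK] := boolP (v \in vertices K).
    by rewrite xf // subrr.
  have zK : boundary L (val z) \in C0 K.
    by have := subvsP z; rewrite memv_cap memv_preim => /andP[].
  by rewrite (C0_supp zK vK) !mul0r subrr.
rewrite /persistent_laplacian0 comp_lfunE adj_c -xS; apply/colP => i; rewrite !mxE.
by have /= -> := boundary_relE c; rewrite boundary_current.
Qed.

(** The vertices of [K] form an orthonormal basis in which the operator has the
    matrix of the Schur complement; [P] and [Q] are the two changes of basis to
    and from the basis used by the characteristic polynomial. *)
Lemma char_poly_persistent :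
  char_poly_lfun (persistent_laplacian0 K L) = char_poly (schur L (vertices K)).
Proof.
set J := vertices K; set S := schur L J; set D := persistent_laplacian0 K L.
set B := vbasis {:subvs_of (C0 K)}.
have B_free : free B by exact: basis_free (vbasisP _).
have B_span x : x = \sum_i coord B i x *: B`_i.
  by apply: coord_vbasis; rewrite memvf.
pose e (v : 'I_#|J|) : subvs_of (C0 K) := vsproj (C0 K) (vertex_chain R (enum_val v)).
have eE v : val (e v) = vertex_chain R (enum_val v).
  apply: vsprojK; apply: memv_span.
  exact: (image_f (fun v => vertex_chain R v)) (enum_valP v).
have valZ a (x : subvs_of (C0 K)) u : val (a *: x) u = a * val x u :> R.
  by rewrite [val _]/(a *: val x) ffunE.
have e_span (x : subvs_of (C0 K)) : x = \sum_v (val x (enum_val v) : R) *: e v.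
  apply: val_inj; apply/ffunP => u; rewrite raddf_sum sum_ffunE /=.
  rewrite (eq_bigr (fun v => val x (enum_val v) * (u == enum_val v)%:R)); last first.
    by move=> v _; rewrite valZ eE !ffunE.
  rewrite -(big_enum_val (A := mem J) (fun v => val x v * (u == v)%:R)).
  have [uJ|uJ] := boolP (u \in J).
    rewrite (bigD1 u) //= eqxx mulr1 big1 ?addr0 // => v /andP[_ vu].
    by rewrite eq_sym (negPf vu) mulr0.
  rewrite (C0_supp (subvsP x) uJ) big1 // => v vJ.
  by case: eqP => [uv|_]; [rewrite uv vJ in uJ | rewrite mulr0].
pose P : 'M[R]_(\dim {:subvs_of (C0 K)}, #|J|) := \matrix_(i, v) val B`_i (enum_val v).
pose Q : 'M[R]_(#|J|, \dim {:subvs_of (C0 K)}) := \matrix_(v, j) coord B j (e v).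
have PQ : P *m Q = 1%:M.
  apply/matrixP => i j; rewrite !mxE -(coord_free i j B_free) (e_span B`_i).
  by rewrite linear_sum /=; apply: eq_bigr => v _; rewrite linearZ !mxE.
have QP : Q *m P = 1%:M.
  apply/matrixP => v u; rewrite !mxE.
  have := congr1 (fun x : subvs_of (C0 K) => val x (enum_val u) : R) (B_span (e v)).
  rewrite /= eE ffunE (inj_eq enum_val_inj) eq_sym => ->.
  rewrite raddf_sum sum_ffunE; apply: eq_bigr => j _.
  by rewrite valZ !mxE.
rewrite -(char_poly_conj S PQ QP) /char_poly_lfun -/D -/B; congr char_poly.
apply/row_matrixP => i; apply/rowP => j.
rewrite !mxE /= passmx.vecof_delta (e_span (D B`_i)) linear_sum /=.
apply: eq_bigr => v _; rewrite linearZ /= [Q _ _]mxE; congr (_ * _).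
have := persistent_laplacian0_schur B`_i => /colP/(_ v); rewrite -/J -/S.
have S_sym : S^T = S by exact: schur_sym.
clearbody S; rewrite [LHS]mxE => ->; rewrite !mxE.
apply: eq_bigr => u _; rewrite mulrC !mxE; congr (_ * _).
by rewrite -[in LHS]S_sym mxE.
Qed.
End PersistentLaplacian.

(** * The Kron reduction and the two bounds *)

Section MatrixLaplacian.
Variables (R : realFieldType) (n : nat) (S : 'M[R]_n).
Hypothesis S_sym : S^T = S.
Hypothesis S_const : S *m const_mx 1 = 0 :> 'cV_n.

Definition offdiag (i j : 'I_n) : R := if i == j then 0 else - S i j.

Lemma offdiagC i j : offdiag i j = offdiag j i.
Proof. by rewrite /offdiag eq_sym -[in LHS]S_sym mxE. Qed.

Lemma row_sum0 i : \sum_j S i j = 0.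
Proof.
move/colP: S_const => /(_ i); rewrite mxE [RHS]mxE => S1; rewrite -[RHS]S1.
by apply: eq_bigr => j _; rewrite mxE mulr1.
Qed.

Lemma offdiag_row_sum i : \sum_j offdiag i j = S i i.
Proof.
have := row_sum0 i; rewrite (bigD1 i) //= => /eqP; rewrite addr_eq0 => /eqP ->.
rewrite (bigD1 i) //= /offdiag eqxx add0r -sumrN; apply: eq_bigr => j ji.
by rewrite eq_sym (negPf ji).
Qed.

(** A symmetric matrix with zero row sums is the Laplacian of the graph whose
    weights are the negated off-diagonal entries. *)
Lemma laplacian_form (f : 'I_n -> R) :
  2 * ((\row_i f i) *m S *m (\row_i f i)^T) 0 0
  = \sum_i \sum_j offdiag i j * (f i - f j) ^+ 2.
Proof.
have -> : ((\row_i f i) *m S *m (\row_i f i)^T) 0 0 = \sum_i \sum_j S i j * (f i * f j).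
  rewrite mxE exchange_big; apply: eq_bigr => j _; rewrite !mxE mulr_suml.
  by apply: eq_bigr => i _; rewrite !mxE; ring.
have r1 : \sum_i \sum_j S i j * f i ^+ 2 = 0.
  by apply: big1 => i _; rewrite -mulr_suml row_sum0 mul0r.
have r2 : \sum_i \sum_j S i j * f j ^+ 2 = 0.
  rewrite exchange_big -[RHS]r1; apply: eq_bigr => i _; apply: eq_bigr => j _ /=.
  by rewrite -[in LHS]S_sym mxE.
have -> : \sum_i \sum_j offdiag i j * (f i - f j) ^+ 2 =
    2 * (\sum_i \sum_j S i j * (f i * f j)) - \sum_i \sum_j S i j * f i ^+ 2
    - \sum_i \sum_j S i j * f j ^+ 2.
  rewrite mulr_sumr -!sumrB; apply: eq_bigr => i _.
  rewrite mulr_sumr -!sumrB; apply: eq_bigr => j _.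
  by rewrite /offdiag; case: eqVneq => [->|_]; ring.
by rewrite r1 r2 !subr0.
Qed.
End MatrixLaplacian.

Section Persistent.
Variables (R : realType) (d : Order.disp_t) (T : finOrderType d).
Variables (K L : wgraph R T).
Hypothesis KL : vertices K \subset vertices L.
Hypothesis hK : (2 <= #|vertices K|)%N.
Local Notation J := (vertices K).
Local Notation S := (schur L J).

(** The characteristic polynomial splits, so the list chosen in the definition
    of the spectrum is a genuine one. *)
Lemma lambda0_second : exists s, [/\ sorted <=%R s,
  char_poly S = \prod_(a <- s) ('X - a%:P) & lambda0 K L 2 = s`_1].
Proof.
pose P (s : seq R) := sorted <=%R s /\
  char_poly_lfun (persistent_laplacian0 K L) = \prod_(a <- s) ('X - a%:P).
have P_ex : exists s, P s.
  rewrite /P char_poly_persistent //.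
  exact: symmetric_char_poly_splits (schur_sym KL).
have [s_sorted sE] : P (spectrum (persistent_laplacian0 K L)).
  exact: (@classical_sets.xgetPex _ [::] P P_ex).
exists (spectrum (persistent_laplacian0 K L)); split=> //.
by rewrite -char_poly_persistent.
Qed.

Lemma eff_conductance_form (A : {set T}) : A \subset J ->
  eff_conductance L A (J :\: A) =
  ((restr J (fun u => (u \in A)%:R))^T *m S *m restr J (fun u => (u \in A)%:R)) 0 0.
Proof.
move=> AJ; rewrite /eff_conductance /eff_resistance div1r invrK.
(* The two index sets of the matrices are equal but not convertible. *)
have AE : A :|: (J :\: A) = J by rewrite -{1}(finset.setIidPr AJ) finset.setID.
by rewrite AE.
Qed.

Lemma form_ge0 (f : 'rV_#|J|) : 0 <= (f *m S *m f^T) 0 0.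
Proof.
have [x xf _] := restr_surj f^T; rewrite -xf -[f]trmxK -xf.
exact: schur_ge0.
Qed.

(** The edge weights of the Kron reduction of [L] onto [J]. *)
Definition kron (i j : 'I_#|J|) : R := offdiag S i j.

Lemma const_restr : (const_mx 1 : 'cV_#|J|) = restr J (fun=> 1 : R).
Proof. by apply/colP => i; rewrite !mxE. Qed.

Lemma schur_const_mx : S *m const_mx 1 = 0 :> 'cV_#|J|.
Proof. by rewrite const_restr schur_const. Qed.

Lemma kron_form (f : 'I_#|J| -> R) :
  2 * ((\row_i f i) *m S *m (\row_i f i)^T) 0 0
  = \sum_i \sum_j kron i j * (f i - f j) ^+ 2.
Proof. exact: laplacian_form (schur_sym KL) schur_const_mx f. Qed.

Lemma kronC i j : kron i j = kron j i.
Proof. exact: offdiagC (schur_sym KL) i j. Qed.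

Lemma kron_ge0 i j : 0 <= kron i j.
Proof.
by rewrite /kron /offdiag; case: eqVneq => // ij; rewrite oppr_ge0 schur_offdiag.
Qed.

Lemma dmax_ge0 : 0 <= dmax K L.
Proof.
apply: (big_ind (fun x => 0 <= x)) => // [x y x0 _|v _]; first by rewrite le_max x0.
by rewrite degE sumr_ge0 // => w _; exact: conductivity_ge0.
Qed.

Lemma deg_le_dmax v : v \in J -> deg L v <= dmax K L.
Proof. by move=> vJ; rewrite /dmax (bigD1 v) //= le_max lexx. Qed.

Lemma kron_deg i : \sum_j kron i j <= dmax K L.
Proof.
rewrite (offdiag_row_sum schur_const_mx); apply: le_trans (schur_diag KL i) _.
by rewrite deg_le_dmax // enum_valP.
Qed.

(** In the reduced graph no vertex is left to eliminate, so the effective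
    conductance between complementary sets is the total weight of their cut. *)
Lemma conductance_cut (A : {set T}) : A \subset J ->
  eff_conductance L A (J :\: A) =
  \sum_(i in enum_val @^-1: A) \sum_(j in ~: (enum_val @^-1: A)) kron i j.
Proof.
move=> AJ; rewrite eff_conductance_form //.
set B := enum_val @^-1: A; pose f i : R := (i \in B)%:R.
have -> : restr J (fun u => (u \in A)%:R) = (\row_i f i)^T.
  by apply/colP => i; rewrite !mxE /f inE.
apply: (@mulfI _ 2); first by rewrite pnatr_eq0.
rewrite trmxK kron_form -(cut_variation kronC).
apply: eq_bigr => i _; apply: eq_bigr => j _; congr (_ * _).
by rewrite /f; case: (i \in B); case: (j \in B);
   rewrite ?subrr ?subr0 ?sub0r ?normrN ?normr0 ?normr1 ?sqrrN ?expr0n ?expr1n.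
Qed.

Lemma cheeger_ge0 : 0 <= cheeger K L.
Proof.
have [A [_ /proper_sub AJ _] [-> _]] := cheeger_min L hK.
rewrite /cheeger_ratio divr_ge0 // conductance_cut //.
by apply: sumr_ge0 => i _; apply: sumr_ge0 => j _; exact: kron_ge0.
Qed.

(** Sets of indices correspond to subsets of [J], and nonempty ones of at most
    half the size to admissible subsets, so [cheeger K L] serves as an
    isoperimetric constant of the reduced graph. *)
Lemma cheeger_le_cut (B : {set 'I_#|J|}) : (2 * #|B| <= #|'I_(#|J|)|)%N ->
  cheeger K L * #|B|%:R <= \sum_(i in B) \sum_(j in ~: B) kron i j.
Proof.
rewrite card_ord => B_half; have [->|B_neq0] := eqVneq B finset.set0.
  by rewrite cards0 mulr0 finset.big_set0.
have B_gt0 : (0 < #|B|)%N by rewrite card_gt0.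
pose A := [set enum_val i | i in B].
have A_card : #|A| = #|B| by rewrite card_imset //; exact: enum_val_inj.
have BE : enum_val @^-1: A = B.
  apply/finset.setP => i; rewrite inE mem_imset //; exact: enum_val_inj.
have AJ : A \subset J by apply/fintype.subsetP => _ /imsetP[i _ ->]; exact: enum_valP.
have A_adm : cheeger_admissible (R := R) K A.
  split; first by rewrite -card_gt0 A_card.
    by rewrite properEcard AJ A_card; lia.
  by rewrite A_card mulrC ler_pdivlMr ?ltr0n // -natrM ler_nat mulnC.
have [A' _ [-> /(_ A A_adm) A'_min]] := cheeger_min L hK.
apply: le_trans (ler_wpM2r (ler0n _ _) A'_min) _.
by rewrite /cheeger_ratio conductance_cut // BE A_card divfK // pnatr_eq0 -lt0n.
Qed.

Theorem persistent_cheeger :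
  cheeger K L ^+ 2 / (2 * dmax K L) <= lambda0 K L 2 /\
  lambda0 K L 2 <= 2 * cheeger K L.
Proof.
have [s [s_sorted sE ->]] := lambda0_second.
have u_neq0 : (const_mx 1 : 'rV[R]_#|J|) != 0.
  apply/rV0Pn; by exists (Ordinal hK); rewrite mxE oner_eq0.
have uS : (const_mx 1 : 'rV[R]_#|J|) *m S = 0.
  apply: trmx_inj; rewrite trmx_mul (schur_sym KL) trmx_const trmx0.
  exact: schur_const_mx.
have ortho (f : 'rV[R]_#|J|) : (f *m (const_mx 1 : 'rV_#|J|)^T) = (\sum_i f 0 i)%:M.
  rewrite [LHS]mx11_scalar mxE; congr (_%:M); apply: eq_bigr => i _.
  by rewrite !mxE mulr1.
have [upper lower] := second_eigenvalue hK (schur_sym KL) u_neq0 uS form_ge0 s_sorted sE.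
have norm (f : 'rV[R]_#|J|) : (f *m f^T) 0 0 = \sum_i f 0 i ^+ 2.
  by rewrite mxE; apply: eq_bigr => i _; rewrite mxE expr2.
split.
  have [f [f_ortho f_gt0 f_form]] := lower.
  have f_sum : \sum_i f 0 i = 0.
    by move: f_ortho; rewrite ortho => /matrixP/(_ 0 0); rewrite !mxE.
  have := weighted_cheeger kron_ge0 kronC kron_deg dmax_ge0 cheeger_ge0
    cheeger_le_cut f_sum.
  have fE : \row_i f 0 i = f by apply/rowP => i; rewrite mxE.
  rewrite -kron_form fE f_form -norm.
  set N := (f *m f^T) 0 0 in f_gt0 *; move=> bound.
  have [d0|d_neq0] := eqVneq (dmax K L) 0.
    (* The quotient is then 0, the inverse of 0 being 0. *)
    rewrite d0 mulr0 invr0 mulr0.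
    by have := form_ge0 f; rewrite f_form pmulr_lge0.
  have d_gt0 : 0 < dmax K L by rewrite lt_def d_neq0 dmax_ge0.
  rewrite ler_pdivrMr ?mulr_gt0 // -(ler_pM2r f_gt0).
  by apply: le_trans bound _; rewrite le_eqVlt; apply/orP; left; apply/eqP; ring.
have [A [A_neq0 A_proper A_half] [-> _]] := cheeger_min L hK.
have AJ := proper_sub A_proper.
set n : R := #|J|%:R; have n_gt0 : 0 < n by rewrite ltr0n; lia.
set a : R := #|A|%:R; have a_gt0 : 0 < a by rewrite ltr0n card_gt0.
pose chi : 'I_#|J| -> R := fun i => (enum_val i \in A)%:R.
have chi_sum : \sum_i chi i = a.
  rewrite -(big_enum_val (A := mem J) (fun v => (v \in A)%:R : R)) /a -sum1_card natr_sum.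
  rewrite [LHS]big_mkcond [RHS]big_mkcond; apply: eq_bigr => v _ /=.
  by case: (boolP (v \in A)) => [/(fintype.subsetP AJ) ->|]; rewrite ?if_same.
(* The trial vector is the indicator of [A], made orthogonal to the constants. *)
pose f i := chi i - a / n.
have f_sum : \sum_i f i = 0.
  rewrite sumrB chi_sum sumr_const card_ord -mulr_natr -/n divfK ?subrr //.
  by rewrite gt_eqF.
have f_norm : \sum_i f i ^+ 2 = a - a ^+ 2 / n.
  have -> : \sum_i f i ^+ 2 = \sum_i (chi i - 2 * (a / n) * chi i + (a / n) ^+ 2).
    by apply: eq_bigr => i _; rewrite /f /chi; case: (_ \in A) => /=; ring.
  rewrite big_split sumrB /= -mulr_sumr chi_sum sumr_const card_ord -mulr_natr -/n.
  by field; rewrite gt_eqF.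
have f_form : ((\row_i f i) *m S *m (\row_i f i)^T) 0 0 = eff_conductance L A (J :\: A).
  apply: (@mulfI _ 2); first by rewrite pnatr_eq0.
  rewrite eff_conductance_form //.
  have -> : restr J (fun u => (u \in A)%:R) = (\row_i chi i)^T.
    by apply/colP => i; rewrite !mxE.
  rewrite trmxK !kron_form; apply: eq_bigr => i _; apply: eq_bigr => j _.
  by rewrite /f; congr (_ * _); ring.
have := upper (\row_i f i); rewrite ortho norm f_form.
under eq_bigr do rewrite mxE; rewrite f_sum raddf0 => /(_ erefl).
under eq_bigr do rewrite mxE; rewrite f_norm /cheeger_ratio -/a.
set C := eff_conductance _ _ _ => bound.
have s_ge0 : 0 <= s`_1.
  have [g [_ g_gt0 g_form]] := lower.
  by have := form_ge0 g; rewrite g_form pmulr_lge0.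
have half : a / 2 <= a - a ^+ 2 / n.
  have : a * (a / n) <= a * 2^-1.
    by apply: ler_wpM2l; [exact: ltW | rewrite ler_pdivrMr].
  by rewrite expr2 mulrA; lra.
rewrite mulrA ler_pdivlMr //.
by have := ler_wpM2l s_ge0 half; lra.
Qed.
End Persistent.

Theorem theorem4p20 (R : realType) (d : Order.disp_t) (T : finOrderType d)
    (K L : wgraph R T) (hKL : graph_pair K L) (hL : connected_graph L)
    (hK : (2 <= #|vertices K|)%N) :
  cheeger K L ^+ 2 / (2 * dmax K L) <= lambda0 K L 2 /\
  lambda0 K L 2 <= 2 * cheeger K L.
Proof. by have [KL _ _] := hKL; exact: persistent_cheeger. Qed.
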